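(* Let $\Lambda$ be a row-finite $k$-graph with no sources, and let $\operatorname{KP}(\Lambda)$ be its Kumjian--Pask algebra over an arbitrary field $\mathsf F$. Then the following are equivalent. (i) $\operatorname{KP}(\Lambda)$ is a prime ring. (ii) For $x,y\in T_\Lambda\setminus\{0\}$, there exist $z\in T_\Lambda\setminus\{0\}$ and $\mathbf n,\mathbf m\in\mathbb N^k$ such that ${}^{\mathbf n}x\ge z$ and ${}^{\mathbf m}y\ge z$. (iii) $\{0\}$ is a prime $\mathbb Z^k$-order ideal of $T_\Lambda$. Consequently, if $\Lambda$ and $\Omega$ are row-finite $k$-graphs without sources such that $T_\Lambda\cong T_\Omega$ as $\mathbb Z^k$-monoids, then $\operatorname{KP}(\Lambda)$ is prime if and only if $\operatorname{KP}(\Omega)$ is prime.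
   Context: $k\ge1$ is an integer, $\mathbb N\ni0$. A $k$-graph is a countable small category $\Lambda$ with a functor $d:\Lambda\to\mathbb N^k$ such that whenever $d(\lambda)=\mathbf m+\mathbf n$ there are unique $\alpha,\beta$ with $d(\alpha)=\mathbf m$, $d(\beta)=\mathbf n$, $\lambda=\alpha\beta$. Objects are identified with $\Lambda^0=d^{-1}(0)$; $r(\lambda),s(\lambda)$ are the codomain and domain of $\lambda$; $v\Lambda^{\mathbf n}=\{\lambda: d(\lambda)=\mathbf n,\ r(\lambda)=v\}$. $\Lambda$ is row-finite if every $v\Lambda^{\mathbf n}$ is finite, and without sources if every $v\Lambda^{\mathbf n}$ is nonempty. The talented monoid $T_\Lambda$ is the commutative monoid generated by symbols $v(\mathbf n)$ ($v\in\Lambda^0$, $\mathbf n\in\mathbb Z^k$) subject to $v(\mathbf n)=\sum_{\alpha\in v\Lambda^{\mathbf m}}s(\alpha)(\mathbf n+\mathbf m)$ for all $v\in\Lambda^0,\mathbf n\in\mathbb Z^k,\mathbf m\in\mathbb N^k$, with $\mathbb Z^k$ acting by monoid automorphisms ${}^{\mathbf q}v(\mathbf n)=v(\mathbf n+\mathbf q)$. $\mathbb Z^k$-monoid isomorphisms are $\mathbb Z^k$-equivariant monoid isomorphisms. The algebraic preorder is $x\le y$ iff $y=x+z$ for some $z$. A $\mathbb Z^k$-order ideal is a submonoid that is a down-set for $\le$ and closed under $\mathbb Z^k$. A proper $\mathbb Z^k$-order ideal $P$ is prime if for $\mathbb Z^k$-order ideals $J_1,J_2$, $J_1\cap J_2\subseteq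 P$ implies $J_1\subseteq P$ or $J_2\subseteq P$. $\operatorname{KP}(\Lambda)=\operatorname{KP}_{\mathsf F}(\Lambda)$ is the universal associative $\mathsf F$-algebra generated by $p_v$ ($v\in\Lambda^0$), $s_\lambda,s_{\lambda^*}$ ($\lambda\in\Lambda\setminus\Lambda^0$) subject to: $p_up_v=\delta_{u,v}p_u$; $s_\lambda s_\mu=s_{\lambda\mu}$, $s_{\mu^*}s_{\lambda^*}=s_{(\lambda\mu)^*}$ when $s(\lambda)=r(\mu)$; $p_{r(\lambda)}s_\lambda=s_\lambda=s_\lambda p_{s(\lambda)}$, $p_{s(\lambda)}s_{\lambda^*}=s_{\lambda^*}=s_{\lambda^*}p_{r(\lambda)}$; $s_{\lambda^*}s_\mu=\delta_{\lambda,\mu}p_{s(\lambda)}$ when $d(\lambda)=d(\mu)$; $p_v=\sum_{\lambda\in v\Lambda^{\mathbf n}}s_\lambda s_{\lambda^*}$ for $v\in\Lambda^0$, $\mathbf n\in\mathbb N^k\setminus\{0\}$. A (not necessarily unital) ring is prime if $\{0\}$ is a prime ideal, where a proper two-sided ideal $P$ is prime if $IJ\subseteq P$ implies $I\subseteq P$ or $J\subseteq P$ for all two-sided ideals $I,J$.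
   Formalization: The equivalences involving (ii) are stated for Λ with at least one vertex: for the empty k-graph KP(Λ)=0 and T_Λ={0}, so (i) and (iii) fail because {0} is not proper, while (ii) holds vacuously. *)

(* Defs.v *)
From HB Require Import structures.
From mathcomp Require Import all_boot all_order all_algebra.
From mathcomp Require Import generic_quotient.
From mathcomp Require Import boolp classical_sets cardinality.

Set Implicit Arguments.
Unset Strict Implicit.
Unset Printing Implicit Defensive.

Import GRing.Theory.

Local Open Scope classical_set_scope.
Local Open Scope quotient_scope.
Local Open Scope ring_scope.

Notation Nk k := {ffun 'I_k -> nat}.
Notation Zk k := {ffun 'I_k -> int}.

Definition natZ (k : nat) (m : Nk k) : Zk k := [ffun i => (m i)%:Z].

(* [kcomp l m] stands for the composite l m, which is defined in the category
   only when [src l = tgt m]; outside of that domain its value is irrelevant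
   and nothing is assumed about it. *)
Record kgraph (k : nat) := KGraph {
  obj : countType;
  mor : countType;
  tgt : mor -> obj;
  src : mor -> obj;
  idm : obj -> mor;
  kcomp : mor -> mor -> mor;
  deg : mor -> Nk k;
  tgt_id : forall v, tgt (idm v) = v;
  src_id : forall v, src (idm v) = v;
  tgt_comp : forall l m, src l = tgt m -> tgt (kcomp l m) = tgt l;
  src_comp : forall l m, src l = tgt m -> src (kcomp l m) = src m;
  comp_idl : forall l, kcomp (idm (tgt l)) l = l;
  comp_idr : forall l, kcomp l (idm (src l)) = l;
  compA : forall l m n, src l = tgt m -> src m = tgt n ->
    kcomp l (kcomp m n) = kcomp (kcomp l m) n;
  deg_id : forall v, deg (idm v) = 0;
  deg_comp : forall l m, src l = tgt m -> deg (kcomp l m) = deg l + deg m;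
  factorization : forall l m n, deg l = m + n ->
    exists! ab : mor * mor,
      [/\ deg ab.1 = m, deg ab.2 = n, src ab.1 = tgt ab.2
        & l = kcomp ab.1 ab.2]
}.

Section HigherRankGraph.
Variables (k : nat) (L : kgraph k).

Definition paths (v : obj L) (n : Nk k) : set (mor L) :=
  [set l | tgt l = v /\ deg l = n].

Definition row_finite := forall v n, finite_set (paths v n).

Definition no_sources := forall v n, paths v n !=set0.

(* The elements of L \ L^0, where L^0 = d^-1(0). *)
Definition nvmor := {l : mor L | deg l != 0}.

End HigherRankGraph.

Definition enumerates (T : eqType) (s : seq T) (A : set T) :=
  uniq s /\ [set` s] = A.

(* The talented monoid: words in the generators v(n), i.e. elements of
   [seq (obj L * Zk k)], modulo the least congruence which makes
   concatenation commutative and contains the defining relations.  A defining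
   relation is imposed for every duplicate-free listing of v L^m; all these
   listings agree up to order, and they exist as soon as L is row-finite. *)

Section TalentedMonoid.
Variables (k : nat) (L : kgraph k).

Definition tword := seq (obj L * Zk k).

Inductive tcong : tword -> tword -> Prop :=
| tcong_refl x : tcong x x
| tcong_sym x y : tcong x y -> tcong y x
| tcong_trans x y z : tcong x y -> tcong y z -> tcong x z
| tcong_cat x x' y y' : tcong x x' -> tcong y y' -> tcong (x ++ y) (x' ++ y')
| tcong_catC x y : tcong (x ++ y) (y ++ x)
| tcong_rel (v : obj L) (n : Zk k) (m : Nk k) (s : seq (mor L)) :
    enumerates s (paths v m) ->
    tcong [:: (v, n)] [seq (src a, n + natZ m) | a <- s].

Definition tcongb : rel tword := fun x y => `[< tcong x y >].

Lemma tcongb_refl : reflexive tcongb.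
Proof. by move=> x; apply/asboolP; constructor. Qed.

Lemma tcongb_sym : symmetric tcongb.
Proof. by move=> x y; apply/asboolP/asboolP; apply: tcong_sym. Qed.

Lemma tcongb_trans : transitive tcongb.
Proof.
move=> y x z /asboolP xy /asboolP yz.
by apply/asboolP; apply: tcong_trans xy yz.
Qed.

Canonical tcong_equiv := EquivRel tcongb tcongb_refl tcongb_sym tcongb_trans.

Definition talented := {eq_quot tcong_equiv}.
HB.instance Definition _ := Choice.on talented.

Definition tpi (x : tword) : talented := \pi_{eq_quot tcong_equiv} x.

Lemma tpiP x y : tpi x = tpi y <-> tcong x y.
Proof.
rewrite /tpi; split; first by move/eqquotP/asboolP.
by move=> h; apply/eqquotP/asboolP.
Qed.

Lemma tpi_surj (t : talented) : exists x, t = tpi x.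
Proof. by exists (repr t); rewrite /tpi reprK. Qed.

Lemma tcong_repr x : tcong (repr (tpi x)) x.
Proof. by apply/tpiP; rewrite {1}/tpi reprK. Qed.

Definition tadd (x y : talented) : talented := tpi (repr x ++ repr y).

Lemma tadd_pi x y : tadd (tpi x) (tpi y) = tpi (x ++ y).
Proof. by apply/tpiP; apply: tcong_cat; apply: tcong_repr. Qed.

Lemma taddA : associative tadd.
Proof.
move=> x y z; have [x' ->] := tpi_surj x; have [y' ->] := tpi_surj y.
by have [z' ->] := tpi_surj z; rewrite !tadd_pi catA.
Qed.

Lemma taddC : commutative tadd.
Proof.
move=> x y; have [x' ->] := tpi_surj x; have [y' ->] := tpi_surj y.
by rewrite !tadd_pi; apply/tpiP; apply: tcong_catC.
Qed.

Lemma tadd0 : left_id (tpi [::]) tadd.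
Proof. by move=> x; have [x' ->] := tpi_surj x; rewrite !tadd_pi. Qed.

HB.instance Definition _ := GRing.isNmodule.Build talented taddA taddC tadd0.

Definition tgen (v : obj L) (n : Zk k) : talented := tpi [:: (v, n)].

Lemma tpiE (x : tword) : tpi x = \sum_(p <- x) tgen p.1 p.2.
Proof.
elim: x => [|[v n] x IH]; first by rewrite big_nil.
by rewrite big_cons -IH -cat1s -tadd_pi.
Qed.

Lemma tgen_rel (v : obj L) (n : Zk k) (m : Nk k) (s : seq (mor L)) :
  enumerates s (paths v m) ->
  tgen v n = \sum_(a <- s) tgen (src a) (n + natZ m).
Proof.
move=> hs; have := tpiE [seq (src a, n + natZ m) | a <- s].
by rewrite big_map => <-; apply/tpiP; apply: tcong_rel.
Qed.

Lemma talented_univ (M : nmodType) (f : obj L -> Zk k -> M) :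
  (forall v n m s, enumerates s (paths v m) ->
     f v n = \sum_(a <- s) f (src a) (n + natZ m)) ->
  exists! g : talented -> M,
    [/\ g 0 = 0, {morph g : x y / x + y} & forall v n, g (tgen v n) = f v n].
Proof.
move=> hf; pose h (x : tword) := \sum_(p <- x) f p.1 p.2.
have hP x y : tcong x y -> h x = h y.
  elim=> {x y} //.
  - by move=> x y z _ -> _ ->.
  - by move=> x x' y y' _ e1 _ e2; rewrite /h !big_cat -!/(h _) e1 e2.
  - by move=> x y; rewrite /h !big_cat /= addrC.
  - by move=> v n m s hs; rewrite /h big_seq1 big_map; apply: hf.
have hpi x : h (repr (tpi x)) = h x by apply: hP; apply: tcong_repr.
exists (fun t : talented => h (repr t)); split.
  split.
  - by rewrite (_ : 0 = tpi [::]) // hpi /h big_nil.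
  - move=> x y; have [x' ->] := tpi_surj x; have [y' ->] := tpi_surj y.
    rewrite (_ : tpi x' + tpi y' = tpi (x' ++ y')); last exact: tadd_pi.
    by rewrite !hpi /h big_cat.
  - by move=> v n; rewrite hpi /h big_seq1.
move=> g [g0 gD gg]; apply/funext => t; have [x ->] := tpi_surj t.
rewrite hpi tpiE; elim: x => [|[v n] x IH]; first by rewrite /h !big_nil g0.
by rewrite big_cons gD -IH gg /h big_cons.
Qed.

Definition tshift (q : Zk k) (x : tword) : tword :=
  [seq (p.1, p.2 + q) | p <- x].

Definition tact (q : Zk k) (t : talented) : talented := tpi (tshift q (repr t)).

Lemma tcong_shift q x y : tcong x y -> tcong (tshift q x) (tshift q y).
Proof.
elim=> {x y}.
- by move=> x; apply: tcong_refl.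
- by move=> x y _; apply: tcong_sym.
- by move=> x y z _ xy _; apply: tcong_trans xy.
- by move=> x x' y y' _ h1 _ h2; rewrite /tshift !map_cat; apply: tcong_cat.
- by move=> x y; rewrite /tshift !map_cat; apply: tcong_catC.
- move=> v n m s hs; have := tcong_rel (n + q) hs.
  rewrite /tshift /= -map_comp /comp /= => h.
  by under eq_map do rewrite /= addrAC.
Qed.

Lemma tact_pi q x : tact q (tpi x) = tpi (tshift q x).
Proof. by apply/tpiP; apply: tcong_shift; apply: tcong_repr. Qed.

Lemma tact_gen q v n : tact q (tgen v n) = tgen v (n + q).
Proof. exact: tact_pi. Qed.

Lemma tact0r q : tact q 0 = 0.
Proof. exact: tact_pi. Qed.

Lemma tactD q : {morph tact q : x y / x + y}.
Proof.
move=> x y; have [x' ->] := tpi_surj x; have [y' ->] := tpi_surj y.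
rewrite (_ : tpi x' + tpi y' = tpi (x' ++ y')); last exact: tadd_pi.
rewrite !tact_pi (_ : _ + _ = tpi (tshift q x' ++ tshift q y')).
  by rewrite /tshift map_cat.
exact: tadd_pi.
Qed.

HB.instance Definition _ q :=
  GRing.isNmodMorphism.Build talented talented (tact q) (tact0r q, @tactD q).

Lemma tact0 t : tact 0 t = t.
Proof.
have [x ->] := tpi_surj t; rewrite tact_pi; congr tpi.
by elim: x => //= -[v n] x ->; rewrite addr0.
Qed.

Lemma tactA p q t : tact p (tact q t) = tact (q + p) t.
Proof.
have [x ->] := tpi_surj t; rewrite !tact_pi; congr tpi.
by elim: x => //= -[v n] x ->; rewrite addrA.
Qed.

Definition tle (x y : talented) := exists z, y = x + z.

Definition order_ideal (J : set talented) :=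
  [/\ J 0,
      forall x y, J x -> J y -> J (x + y),
      forall x y, tle x y -> J y -> J x
    & forall q x, J x -> J (tact q x)].

Definition prime_order_ideal (P : set talented) :=
  [/\ order_ideal P, P <> setT
    & forall J1 J2, order_ideal J1 -> order_ideal J2 ->
        J1 `&` J2 `<=` P -> J1 `<=` P \/ J2 `<=` P].

Definition talented_downward_directed :=
  forall x y : talented, x <> 0 -> y <> 0 ->
    exists (z : talented) (n m : Nk k),
      [/\ z <> 0, tle z (tact (natZ n) x) & tle z (tact (natZ m) y)].

End TalentedMonoid.

Definition talented_iso (k : nat) (L M : kgraph k) :=
  exists f : {additive talented L -> talented M},
    bijective f /\ forall q x, f (tact q x) = tact q (f x).

HB.mixin Record Zmodule_isRng R of GRing.Zmodule R := {
  rmul : R -> R -> R;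
  rmulA : associative rmul;
  rmulDl : left_distributive rmul +%R;
  rmulDr : right_distributive rmul +%R
}.

#[short(type="rngType")]
HB.structure Definition Rng := {R of Zmodule_isRng R & GRing.Zmodule R}.

HB.mixin Record LmoduleRng_isNalgebra (F : pzRingType) A
    of GRing.Lmodule F A & Rng A := {
  rscaleAl : forall (a : F) (x y : A), rmul (a *: x) y = a *: rmul x y;
  rscaleAr : forall (a : F) (x y : A), rmul x (a *: y) = a *: rmul x y
}.

#[short(type="nalgType")]
HB.structure Definition Nalgebra (F : pzRingType) :=
  {A of LmoduleRng_isNalgebra F A & GRing.Lmodule F A & Rng A}.

Section PrimeRing.
Variable R : rngType.

(* Ideals of R as a ring: for an F-algebra, stability under the scalars is not
   required. *)
Definition ring_ideal (I : set R) :=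
  [/\ I 0,
      forall x y, I x -> I y -> I (x - y),
      forall a x, I x -> I (rmul a x)
    & forall a x, I x -> I (rmul x a)].

Definition ideal_mul (I J : set R) : set R :=
  [set x | exists2 s : seq (R * R),
     (forall p, p \in s -> I p.1 /\ J p.2) & x = \sum_(p <- s) rmul p.1 p.2].

Definition prime_ring_ideal (P : set R) :=
  [/\ ring_ideal P, P <> setT
    & forall I J, ring_ideal I -> ring_ideal J ->
        ideal_mul I J `<=` P -> I `<=` P \/ J `<=` P].

Definition prime_ring := prime_ring_ideal [set 0].

End PrimeRing.

(* The Kumjian-Pask algebra: formal non-unital F-algebra expressions in the
   generators, modulo the least congruence containing the laws of associative
   F-algebras and the defining relations. *)

Section KumjianPask.
Variables (F : fieldType) (k : nat) (L : kgraph k).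

Inductive kterm : Type :=
| kP (v : obj L)
| kS (l : nvmor L)
| kSs (l : nvmor L)
| k0
| kadd (x y : kterm)
| kopp (x : kterm)
| kscale (a : F) (x : kterm)
| kmul (x y : kterm).

(* In [kc_SS] and [kc_SsSs], [n] is the composite of [l] and [m], packaged with
   the proof that its degree is nonzero.  The constructors before [kc_PP] make
   the quotient an associative F-algebra. *)
Inductive kcong : kterm -> kterm -> Prop :=
| kc_refl x : kcong x x
| kc_sym x y : kcong x y -> kcong y x
| kc_trans x y z : kcong x y -> kcong y z -> kcong x z
| kc_add x x' y y' : kcong x x' -> kcong y y' -> kcong (kadd x y) (kadd x' y')
| kc_opp x x' : kcong x x' -> kcong (kopp x) (kopp x')
| kc_scale a x x' : kcong x x' -> kcong (kscale a x) (kscale a x')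
| kc_mul x x' y y' : kcong x x' -> kcong y y' -> kcong (kmul x y) (kmul x' y')
| kc_addA x y z : kcong (kadd x (kadd y z)) (kadd (kadd x y) z)
| kc_addC x y : kcong (kadd x y) (kadd y x)
| kc_add0 x : kcong (kadd k0 x) x
| kc_addN x : kcong (kadd (kopp x) x) k0
| kc_scaleA a b x : kcong (kscale a (kscale b x)) (kscale (a * b) x)
| kc_scale1 x : kcong (kscale 1 x) x
| kc_scaleDr a x y : kcong (kscale a (kadd x y)) (kadd (kscale a x) (kscale a y))
| kc_scaleDl a b x : kcong (kscale (a + b) x) (kadd (kscale a x) (kscale b x))
| kc_mulA x y z : kcong (kmul x (kmul y z)) (kmul (kmul x y) z)
| kc_mulDl x y z : kcong (kmul (kadd x y) z) (kadd (kmul x z) (kmul y z))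
| kc_mulDr x y z : kcong (kmul x (kadd y z)) (kadd (kmul x y) (kmul x z))
| kc_scaleAl a x y : kcong (kmul (kscale a x) y) (kscale a (kmul x y))
| kc_scaleAr a x y : kcong (kmul x (kscale a y)) (kscale a (kmul x y))
| kc_PP u v : kcong (kmul (kP u) (kP v)) (if u == v then kP u else k0)
| kc_SS (l m n : nvmor L) :
    src (val l) = tgt (val m) -> val n = kcomp (val l) (val m) ->
    kcong (kmul (kS l) (kS m)) (kS n)
| kc_SsSs (l m n : nvmor L) :
    src (val l) = tgt (val m) -> val n = kcomp (val l) (val m) ->
    kcong (kmul (kSs m) (kSs l)) (kSs n)
| kc_PS l : kcong (kmul (kP (tgt (val l))) (kS l)) (kS l)
| kc_SP l : kcong (kmul (kS l) (kP (src (val l)))) (kS l)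
| kc_PSs l : kcong (kmul (kP (src (val l))) (kSs l)) (kSs l)
| kc_SsP l : kcong (kmul (kSs l) (kP (tgt (val l)))) (kSs l)
| kc_SsS l m : deg (val l) = deg (val m) ->
    kcong (kmul (kSs l) (kS m)) (if l == m then kP (src (val l)) else k0)
| kc_sum (v : obj L) (n : Nk k) (s : seq (nvmor L)) :
    n != 0 -> enumerates (map val s) (paths v n) ->
    kcong (kP v) (\big[kadd/k0]_(l <- s) kmul (kS l) (kSs l)).

HB.instance Definition _ := gen_eqMixin kterm.
HB.instance Definition _ := gen_choiceMixin kterm.

Definition kcongb : rel kterm := fun x y => `[< kcong x y >].

Lemma kcongb_refl : reflexive kcongb.
Proof. by move=> x; apply/asboolP; constructor. Qed.

Lemma kcongb_sym : symmetric kcongb.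
Proof. by move=> x y; apply/asboolP/asboolP; apply: kc_sym. Qed.

Lemma kcongb_trans : transitive kcongb.
Proof.
move=> y x z /asboolP xy /asboolP yz.
by apply/asboolP; apply: kc_trans xy yz.
Qed.

Canonical kcong_equiv := EquivRel kcongb kcongb_refl kcongb_sym kcongb_trans.

Definition KP := {eq_quot kcong_equiv}.
HB.instance Definition _ := Choice.on KP.

Definition kpi (x : kterm) : KP := \pi_{eq_quot kcong_equiv} x.

Lemma kpiP x y : kpi x = kpi y <-> kcong x y.
Proof.
rewrite /kpi; split; first by move/eqquotP/asboolP.
by move=> h; apply/eqquotP/asboolP.
Qed.

Lemma kpi_surj (t : KP) : exists x, t = kpi x.
Proof. by exists (repr t); rewrite /kpi reprK. Qed.

Lemma kcong_repr x : kcong (repr (kpi x)) x.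
Proof. by apply/kpiP; rewrite {1}/kpi reprK. Qed.

Definition KPadd (x y : KP) : KP := kpi (kadd (repr x) (repr y)).
Definition KPopp (x : KP) : KP := kpi (kopp (repr x)).
Definition KPscale (a : F) (x : KP) : KP := kpi (kscale a (repr x)).
Definition KPmul (x y : KP) : KP := kpi (kmul (repr x) (repr y)).

Lemma KPadd_pi x y : KPadd (kpi x) (kpi y) = kpi (kadd x y).
Proof. by apply/kpiP; apply: kc_add; apply: kcong_repr. Qed.

Lemma KPopp_pi x : KPopp (kpi x) = kpi (kopp x).
Proof. by apply/kpiP; apply: kc_opp; apply: kcong_repr. Qed.

Lemma KPscale_pi a x : KPscale a (kpi x) = kpi (kscale a x).
Proof. by apply/kpiP; apply: kc_scale; apply: kcong_repr. Qed.

Lemma KPmul_pi x y : KPmul (kpi x) (kpi y) = kpi (kmul x y).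
Proof. by apply/kpiP; apply: kc_mul; apply: kcong_repr. Qed.

Definition KP_piE := (KPadd_pi, KPopp_pi, KPscale_pi, KPmul_pi).

Local Ltac kp_lift c :=
  repeat (let x := fresh "x" in
    move=> x; try (have [? ->] := kpi_surj x));
  rewrite ?KP_piE; apply/kpiP; apply: c.

Lemma KPaddA : associative KPadd. Proof. by kp_lift kc_addA. Qed.
Lemma KPaddC : commutative KPadd. Proof. by kp_lift kc_addC. Qed.
Lemma KPadd0 : left_id (kpi k0) KPadd. Proof. by kp_lift kc_add0. Qed.
Lemma KPaddN : left_inverse (kpi k0) KPopp KPadd.
Proof. by kp_lift kc_addN. Qed.

HB.instance Definition _ := GRing.isZmodule.Build KP KPaddA KPaddC KPadd0 KPaddN.

Lemma KPscaleA a b x : KPscale a (KPscale b x) = KPscale (a * b) x.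
Proof. by move: x; kp_lift kc_scaleA. Qed.
Lemma KPscale1 : left_id 1 KPscale. Proof. by kp_lift kc_scale1. Qed.
Lemma KPscaleDr : right_distributive KPscale KPadd.
Proof. by kp_lift kc_scaleDr. Qed.
Lemma KPscaleDl x : {morph KPscale^~ x : a b / a + b >-> KPadd a b}.
Proof. by move=> a b; move: x; kp_lift kc_scaleDl. Qed.

HB.instance Definition _ :=
  GRing.Zmodule_isLmodule.Build F KP KPscaleA KPscale1 KPscaleDr KPscaleDl.

Lemma KPmulA : associative KPmul. Proof. by kp_lift kc_mulA. Qed.
Lemma KPmulDl : left_distributive KPmul KPadd. Proof. by kp_lift kc_mulDl. Qed.
Lemma KPmulDr : right_distributive KPmul KPadd. Proof. by kp_lift kc_mulDr. Qed.

HB.instance Definition _ := Zmodule_isRng.Build KP KPmulA KPmulDl KPmulDr.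

Lemma KPscaleAl a x y : KPmul (KPscale a x) y = KPscale a (KPmul x y).
Proof. by move: x y; kp_lift kc_scaleAl. Qed.
Lemma KPscaleAr a x y : KPmul x (KPscale a y) = KPscale a (KPmul x y).
Proof. by move: x y; kp_lift kc_scaleAr. Qed.

HB.instance Definition _ :=
  LmoduleRng_isNalgebra.Build F KP KPscaleAl KPscaleAr.

Definition KPp (v : obj L) : KP := kpi (kP v).
Definition KPs (l : nvmor L) : KP := kpi (kS l).
Definition KPss (l : nvmor L) : KP := kpi (kSs l).

End KumjianPask.

Section KPFamily.
Variables (F : fieldType) (k : nat) (L : kgraph k) (A : nalgType F).
Variables (p : obj L -> A) (s ss : nvmor L -> A).

Definition KPfamily :=
  [/\ forall u v, rmul (p u) (p v) = if u == v then p u else 0,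
      forall l m n : nvmor L,
        src (val l) = tgt (val m) -> val n = kcomp (val l) (val m) ->
        rmul (s l) (s m) = s n /\ rmul (ss m) (ss l) = ss n,
      forall l : nvmor L,
        [/\ rmul (p (tgt (val l))) (s l) = s l,
            rmul (s l) (p (src (val l))) = s l,
            rmul (p (src (val l))) (ss l) = ss l
          & rmul (ss l) (p (tgt (val l))) = ss l],
      forall l m : nvmor L, deg (val l) = deg (val m) ->
        rmul (ss l) (s m) = if l == m then p (src (val l)) else 0
    & forall (v : obj L) (n : Nk k) (e : seq (nvmor L)), n != 0 ->
        enumerates (map val e) (paths v n) ->
        p v = \sum_(l <- e) rmul (s l) (ss l)].

End KPFamily.

Section KPUniversal.
Variables (F : fieldType) (k : nat) (L : kgraph k).

Lemma KP_family : KPfamily (@KPp F k L) (@KPs F k L) (@KPss F k L).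
Proof.
have mE x y : rmul (kpi x) (kpi y : KP F L) = kpi (kmul x y).
  exact: KPmul_pi.
split.
- by move=> u v; rewrite mE (_ : 0 = kpi (k0 F L)) // -fun_if; apply/kpiP/kc_PP.
- move=> l m n lm e; rewrite !mE.
  by split; apply/kpiP; [apply: kc_SS lm e|apply: kc_SsSs lm e].
- move=> l; rewrite !mE; split; apply/kpiP;
    [exact: kc_PS|exact: kc_SP|exact: kc_PSs|exact: kc_SsP].
- move=> l m e; rewrite mE (_ : 0 = kpi (k0 F L)) // -fun_if.
  by apply/kpiP/kc_SsS.
- move=> v n e n0 he; transitivity
    (kpi (\big[@kadd F k L/k0 F L]_(l <- e) kmul (kS F l) (kSs F l))).
    by apply/kpiP; apply: kc_sum n0 he.
  elim: e {he} => [|l e IH]; first by rewrite !big_nil.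
  by rewrite !big_cons -KPadd_pi -IH -KPmul_pi.
Qed.

Lemma KP_univ (A : nalgType F) (p : obj L -> A) (s ss : nvmor L -> A) :
  KPfamily p s ss ->
  exists! g : KP F L -> A,
    [/\ linear g, {morph g : x y / rmul x y},
        forall v, g (KPp F v) = p v, forall l, g (KPs F l) = s l
      & forall l, g (KPss F l) = ss l].
Proof.
move=> [PP SS PS SsS Psum].
pose fix h (x : kterm F L) : A := match x with
  | kP v => p v | kS l => s l | kSs l => ss l | k0 => 0
  | kadd x y => h x + h y | kopp x => - h x | kscale a x => a *: h x
  | kmul x y => rmul (h x) (h y) end.
have hP x y : kcong x y -> h x = h y.
  elim=> {x y} //=.
  - by move=> x y z _ -> _ ->.
  - by move=> x x' y y' _ -> _ ->.
  - by move=> x x' _ ->.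
  - by move=> a x x' _ ->.
  - by move=> x x' y y' _ -> _ ->.
  - by move=> x y z; rewrite addrA.
  - by move=> x y; rewrite addrC.
  - by move=> x; rewrite add0r.
  - by move=> x; rewrite addNr.
  - by move=> a b x; rewrite scalerA.
  - by move=> x; rewrite scale1r.
  - by move=> a x y; rewrite scalerDr.
  - by move=> a b x; rewrite scalerDl.
  - by move=> x y z; rewrite rmulA.
  - by move=> x y z; rewrite rmulDl.
  - by move=> x y z; rewrite rmulDr.
  - by move=> a x y; rewrite rscaleAl.
  - by move=> a x y; rewrite rscaleAr.
  - by move=> u v; rewrite PP; case: ifP.
  - by move=> l m n lm e; have [] := SS _ _ _ lm e.
  - by move=> l m n lm e; have [] := SS _ _ _ lm e.
  - by move=> l; have [] := PS l.
  - by move=> l; have [] := PS l.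
  - by move=> l; have [] := PS l.
  - by move=> l; have [] := PS l.
  - by move=> l m e; rewrite SsS //; case: ifP.
  - move=> v n e n0 he; rewrite (Psum _ _ _ n0 he).
    by elim: e {he} => [|l e IH]; rewrite ?big_nil // !big_cons /= IH.
have hpi x : h (repr (kpi x)) = h x by apply: hP; apply: kcong_repr.
exists (fun t : KP F L => h (repr t)); split.
  split.
  - move=> a x y; have [x' ->] := kpi_surj x; have [y' ->] := kpi_surj y.
    rewrite (_ : a *: kpi x' + kpi y' = kpi (kadd (kscale a x') y')).
      by rewrite !hpi.
    by rewrite -KPadd_pi -KPscale_pi.
  - move=> x y; have [x' ->] := kpi_surj x; have [y' ->] := kpi_surj y.
    rewrite (_ : rmul (kpi x') (kpi y') = kpi (kmul x' y')) ?hpi //.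
    exact: KPmul_pi.
  - by move=> v; rewrite hpi.
  - by move=> l; rewrite hpi.
  - by move=> l; rewrite hpi.
move=> g [gl gM gp gs gss].
have g0 : g 0 = 0.
  by have := gl (-1) 0 0; rewrite scaler0 addr0 scaleN1r addNr.
have gZ a x : g (a *: x) = a *: g x.
  by have := gl a x 0; rewrite !addr0 g0 addr0.
have gD x y : g (x + y) = g x + g y.
  by have := gl 1 x y; rewrite !scale1r.
apply/funext => t; have [x ->] := kpi_surj t; rewrite hpi.
elim: x => /= [v|l|l||x IHx y IHy|x IHx|a x IHx|x IHx y IHy].
- by rewrite gp.
- by rewrite gs.
- by rewrite gss.
- by rewrite -[kpi _]/(0 : KP F L) g0.
- by rewrite -KPadd_pi IHx IHy -gD.
- by rewrite -KPopp_pi -scaleN1r IHx -gZ scaleN1r.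
- by rewrite -KPscale_pi IHx -gZ.
- by rewrite -KPmul_pi IHx IHy -gM.
Qed.

End KPUniversal.

(* Main.v *)
Require Import Defs.
From mathcomp Require Import all_boot all_order all_algebra.
From mathcomp Require Import boolp classical_sets cardinality.
From HB Require Import structures.

Set Implicit Arguments.
Unset Strict Implicit.
Unset Printing Implicit Defensive.

Import Order.TTheory GRing.Theory Num.Theory.

Local Open Scope classical_set_scope.
Local Open Scope ring_scope.

(* Each condition amounts to any two vertices v, w reaching a common vertex t,
   together with Lambda being nonempty in the case of (i) and (iii).

   For the monoid: if u(q) lies below v(n), then u belongs to the saturation of
   the hereditary set generated by v, because "some letter of the word is
   outside a given saturated hereditary set" is invariant under the defining
   congruence.  Two saturations meeting in u give a common descendant of v and w.

   For the algebra: if v and w have no common descendant then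
   p_v KP p_w = 0 while p_v, p_w are nonzero.  Conversely KP is graded by Z^k,
   which is ordered lexicographically.  All terms s_l s_m^* of a homogeneous
   element can be taken with l of one fixed degree and m of another, so s_l^*
   and s_m extract its coefficients.  Hence a nonzero ideal contains some
   p_v plus terms of negative degree, and then the same with v replaced by any
   t reached from v.  Two such elements for the same t have a product of
   the same form, which is nonzero. *)

(** * Degrees and their lexicographic order *)

Section Degrees.
Variable k : nat.
Implicit Types (m n : Nk k) (g h : Zk k).

Lemma natZD m n : natZ (m + n) = natZ m + natZ n.
Proof. by apply/ffunP => i; rewrite !ffunE PoszD. Qed.

Lemma natZ0 : natZ (0 : Nk k) = 0.
Proof. by apply/ffunP => i; rewrite !ffunE. Qed.

Lemma natZ_inj : injective (@natZ k).
Proof.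
move=> m n /ffunP e; apply/ffunP => i; have := e i; rewrite !ffunE.
by case.
Qed.

Lemma Nk_addIr n : injective (fun m : Nk k => m + n).
Proof.
move=> m m' /ffunP e; apply/ffunP => i; have := e i; rewrite !ffunE.
exact: addIn.
Qed.

(** The shifts are the positive and negative parts of [h - g], taken coordinatewise. *)
Lemma natZ_directed g h : exists m n, g + natZ m = h + natZ n.
Proof.
exists [ffun i => if g i <= h i then `|h i - g i|%N else 0%N].
exists [ffun i => if g i <= h i then 0%N else `|g i - h i|%N].
apply/ffunP => i; rewrite !ffunE; case: (lerP (g i) (h i)) => gh.
  by rewrite gez0_abs ?subr_ge0 // subrKC addr0.
by rewrite gez0_abs ?subr_ge0 ?(ltW gh) // subrKC addr0.
Qed.

Lemma Nk_add_eq0 m n : m + n = 0 -> m = 0.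
Proof.
move/ffunP => e; apply/ffunP => i; have := e i; rewrite !ffunE.
by move/eqP; rewrite addn_eq0 => /andP[/eqP].
Qed.

Definition lexpos g :=
  exists2 i : 'I_k, 0 < g i & forall j : 'I_k, (j < i)%N -> g j = 0.

Lemma lexposD g h : lexpos g -> lexpos h -> lexpos (g + h).
Proof.
move=> [i gi gj] [i' hi hj]; case: (ltngtP i i') => [lt|lt|/val_inj e].
- exists i => [|j ji]; rewrite ffunE; first by rewrite (hj i) // addr0.
  by rewrite gj // hj // (ltn_trans ji).
- exists i' => [|j ji]; rewrite ffunE; first by rewrite (gj i') // add0r.
  by rewrite hj // gj // (ltn_trans ji).
- subst i'; exists i => [|j ji]; rewrite ffunE; first exact: addr_gt0.
  by rewrite gj // hj.
Qed.

Lemma lexpos_neq0 g : lexpos g -> g <> 0.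
Proof. by move=> [i + _] g0; rewrite g0 ffunE ltxx. Qed.

Lemma lexpos_total g : [\/ g = 0, lexpos g | lexpos (- g)].
Proof.
case: (pickP (fun i => g i != 0)) => [i0 gi0|g0]; last first.
  by constructor 1; apply/ffunP => i; have := g0 i; rewrite ffunE => /eqP.
case: (@arg_minnP _ i0 (fun i => g i != 0) (@nat_of_ord k) gi0) => i gi mini.
have gj (j : 'I_k) : (j < i)%N -> g j = 0.
  by move=> ji; apply/eqP/negPn/negP => /mini; rewrite leqNgt ji.
case/lt_total/orP: gi => gi; [constructor 3|constructor 2]; exists i => //.
  by rewrite ffunE oppr_gt0.
by move=> j ji; rewrite ffunE gj ?oppr0.
Qed.

Definition lexneg g := lexpos (- g).

Lemma lexnegD g h : lexneg g -> lexneg h -> lexneg (g + h).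
Proof. by rewrite /lexneg opprD; apply: lexposD. Qed.

Lemma lexneg_neq0 g : lexneg g -> g <> 0.
Proof. by move/lexpos_neq0 => + e; rewrite e oppr0. Qed.

Lemma lex_max (s : seq (Zk k)) : s != [::] ->
  exists2 g, g \in s & forall h, h \in s -> h = g \/ lexpos (g - h).
Proof.
elim: s => // a s IH _; have [->|/IH[g gs gmax]] := eqVneq s [::].
  by exists a => [|h]; rewrite ?mem_head // inE => /eqP ->; left.
have [e|ga|ag] := lexpos_total (g - a).
- exists g => [|h]; rewrite inE ?gs ?orbT // => /orP[/eqP ->|/gmax //].
  by left; move/subr0_eq: e.
- exists g => [|h]; rewrite inE ?gs ?orbT // => /orP[/eqP ->|/gmax //].
  by right.
- exists a => [|h]; rewrite ?mem_head // inE => /orP[/eqP ->|]; first by left.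
  rewrite opprB in ag.
  case/gmax=> [->|gh]; right => //.
  by rewrite -(subrKA g); apply: lexposD.
Qed.

End Degrees.

(** * Unique factorization and reachability *)

Section Paths.
Variables (k : nat) (L : kgraph k).
Implicit Types (v w t u : obj L) (l m a b : mor L) (n : Nk k).

Lemma factor l (m n : Nk k) : deg l = m + n -> exists a b,
  [/\ deg a = m, deg b = n, src a = tgt b & l = kcomp a b].
Proof. by move/factorization => [[a b] [[/= ? ? ? ?] _]]; exists a, b. Qed.

(** The second factors also have equal degrees, by cancellation in [Nk k], so both pairs factor the
    same path at the same degrees. *)
Lemma comp_inj l l' a a' : src l = tgt a -> src l' = tgt a' ->
  deg l = deg l' -> kcomp l a = kcomp l' a' -> l = l' /\ a = a'.
Proof.
move=> la la' dl e.
have da : deg a' = deg a.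
  apply: (@Nk_addIr k (deg l)); rewrite -[LHS]addrC -[RHS]addrC -(deg_comp la) e.
  by rewrite dl deg_comp.
have [x [_ ux]] := factorization (deg_comp la).
have e1 := ux (l, a) (And4 erefl erefl la erefl).
have e2 := ux (l', a') (And4 (esym dl) da la' e).
by have [-> ->] : (l, a) = (l', a') by rewrite -e1 -e2.
Qed.

(** Composing [l] with the identity on either side gives two factorizations of [l] with equal
    degrees, so their first factors agree. *)
Lemma deg0_id l : deg l = 0 -> l = idm (tgt l).
Proof.
move=> dl; have [] // := @comp_inj l (idm (tgt l)) (idm (src l)) l.
- by rewrite tgt_id.
- by rewrite src_id.
- by rewrite deg_id.
- by rewrite comp_idl comp_idr.
Qed.

Definition reach v t := exists2 l, tgt l = v & src l = t.

Lemma reach_refl v : reach v v.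
Proof. by exists (idm v); rewrite ?tgt_id ?src_id. Qed.

Lemma reach_trans v w t : reach v w -> reach w t -> reach v t.
Proof.
move=> [l lv lw] [m mw mt]; exists (kcomp l m).
  by rewrite tgt_comp // lw.
by rewrite src_comp // lw.
Qed.

Definition downward_directed := forall v w, exists2 t, reach v t & reach w t.

Lemma row_finite_enum v n : row_finite L -> exists s, enumerates s (paths v n).
Proof.
move=> /(_ v n)/finite_seqP[s e]; exists (undup s); split.
  exact: undup_uniq.
by rewrite e; apply/seteqP; split=> x /=; rewrite mem_undup.
Qed.

Lemma enum_paths s v n l : enumerates s (paths v n) ->
  (l \in s) <-> (tgt l = v /\ deg l = n).
Proof. by move=> [_ /seteqP[s1 s2]]; split; [apply: s1|apply: s2]. Qed.

End Paths.

(** * The talented monoid *)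

Section Talented.
Variables (k : nat) (L : kgraph k).
Hypotheses (Lfin : row_finite L) (Lsrc : no_sources L).
Implicit Types (v w t u : obj L) (x y z : talented L) (n m : Nk k).

(* The complements of such predicates are the saturated hereditary sets of
   vertices. *)
Definition branching (P : obj L -> Prop) := forall v n,
  P v <-> exists l, [/\ tgt l = v, deg l = n & P (src l)].

Definition whit (P : obj L -> Prop) (x : tword L) := exists2 p, p \in x & P p.1.

Lemma whit_cat P (x y : tword L) : whit P (x ++ y) <-> whit P x \/ whit P y.
Proof.
split=> [[p]|[] [p px Pp]].
- by rewrite mem_cat => /orP[] px Pp; [left|right]; exists p.
- by exists p; rewrite // mem_cat px.
- by exists p; rewrite // mem_cat px orbT.
Qed.

(** A defining relation replaces the letter [v] by the sources of the paths in v L^m, and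
    [branching] says that [P v] holds exactly when [P] holds at one of these. *)
Lemma whit_cong P (x y : tword L) : branching P -> tcong x y ->
  whit P x <-> whit P y.
Proof.
move=> Pb; elim=> {x y} //.
- by move=> x y _ ->.
- by move=> x y z _ -> _ ->.
- by move=> x x' y y' _ ex _ ey; rewrite !whit_cat ex ey.
- by move=> x y; rewrite !whit_cat; tauto.
- move=> v n m s es; split.
    case=> p; rewrite inE => /eqP -> /= /(Pb v m)[l [lv dl Pl]].
    exists (src l, n + natZ m) => //; apply/mapP; exists l => //.
    exact/(enum_paths _ es).
  case=> _ /mapP[l /(enum_paths _ es)[lv lm] ->] /= Pl.
  by exists (v, n); rewrite ?mem_head //=; apply/(Pb v m); exists l.
Qed.

(** The representative is arbitrary; for branching [P] the choice does not matter, by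
    [whit_cong]. *)
Definition hit P x := whit P (repr x).

Lemma hit_pi P (w : tword L) : branching P -> hit P (tpi w) <-> whit P w.
Proof. by move=> Pb; apply: whit_cong Pb (tcong_repr w). Qed.

Lemma hitD P x y : branching P -> hit P (x + y) <-> hit P x \/ hit P y.
Proof.
move=> Pb; have [x' ->] := tpi_surj x; have [y' ->] := tpi_surj y.
rewrite (_ : tpi x' + tpi y' = tpi (x' ++ y')); last exact: tadd_pi.
by rewrite !hit_pi // whit_cat.
Qed.

Lemma hit0 P : branching P -> ~ hit P (0 : talented L).
Proof. by move=> Pb /(hit_pi _ Pb)[]. Qed.

Lemma hit_act P q x : branching P -> hit P (tact q x) <-> hit P x.
Proof.
move=> Pb; have [x' ->] := tpi_surj x; rewrite tact_pi !hit_pi //.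
split=> [[_ /mapP[p px ->] Pp]|[p px Pp]]; first by exists p.
by exists (p.1, p.2 + q) => //; apply/mapP; exists p.
Qed.

Lemma hit_gen P v q : branching P -> hit P (tgen v q) <-> P v.
Proof.
move=> Pb; rewrite hit_pi //; split=> [[p]|Pv].
  by rewrite inE => /eqP ->.
by exists (v, q); rewrite ?mem_head.
Qed.

Lemma branching_True : branching (fun=> True).
Proof.
by move=> v n; split=> // _; have [l [lv ln]] := Lsrc v n; exists l.
Qed.

(** The trivial predicate is hit by exactly the nonempty words. It is branching because there are no
    sources, so no nonempty word is congruent to the empty one. *)
Lemma hit_neq0 x : hit (fun=> True) x <-> x <> 0.
Proof.
split=> [hx x0|x0]; first by apply: (hit0 branching_True); rewrite -x0.
have [w e] := tpi_surj x; rewrite e hit_pi; last exact: branching_True.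
by case: w e => [//|p w] _; exists p; rewrite ?mem_head.
Qed.

Lemma tgen_neq0 v q : tgen v q <> 0.
Proof. by apply/hit_neq0/hit_gen => //; apply: branching_True. Qed.

(** This is the order ideal attached to the saturated hereditary set that is the complement of
    [P]. *)
Lemma nohit_ideal P : branching P -> order_ideal [set x | ~ hit P x].
Proof.
move=> Pb; split=> /=.
- exact: hit0.
- by move=> x y hx hy /(hitD _ _ Pb)[].
- by move=> x y [z ->] + hx; apply; apply/hitD => //; left.
- by move=> q x + hx; apply; apply/hit_act/hx.
Qed.

(* The saturation of the hereditary set of vertices reached from [v]. *)
Definition sat v u := exists n, forall l, tgt l = u -> deg l = n -> reach v (src l).

(** The exponent [n] for [tgt l] serves [src l] too: for [l'] of degree [n] with target [src l], the
    initial segment of degree [n] of [kcomp l l'] already has its source reached from [v]. *)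
Lemma sat_reach v l : sat v (tgt l) -> sat v (src l).
Proof.
move=> [n sv]; exists n => l' l'l dl'.
have cl : src l = tgt l' by [].
have [a [b [da db ab e]]] : exists a b, [/\ deg a = n, deg b = deg l,
   src a = tgt b & kcomp l l' = kcomp a b].
  by apply: factor; rewrite deg_comp // dl' addrC.
rewrite -(src_comp cl) e src_comp //; apply: reach_trans (sv a _ da) _.
  by rewrite -(tgt_comp cl) e tgt_comp.
by exists b.
Qed.

Lemma sat_branching v : branching (fun u => ~ sat v u).
Proof.
move=> u n; split; last first.
  by move=> [l [lu _ nl]] su; apply/nl/sat_reach; rewrite lu.
move=> nu; apply: contrapT => nl; apply: nu.
have [s es] := row_finite_enum u n Lfin.
have sl l : l \in s -> sat v (src l).
  move=> /(enum_paths _ es)[lu ln]; apply: contrapT => nsl; apply: nl.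
  by exists l.
(* Row-finiteness leaves finitely many exponents to reconcile; their sum works, since [aux] lets an
   exponent grow. *)
have [M sM] : exists M : Nk k, forall l, l \in s -> forall l',
    tgt l' = src l -> deg l' = M -> reach v (src l').
  elim: s {es} sl => [|l s IH] sl; first by exists 0.
  have [M sM] := IH (fun l' h => sl l' (mem_behead (s := l :: s) h)).
  have [N sN] := sl l (mem_head _ _).
  have aux A B w : (forall l', tgt l' = w -> deg l' = A -> reach v (src l')) ->
      forall l', tgt l' = w -> deg l' = A + B -> reach v (src l').
    move=> hA l' l'w /factor[a [b [da db ab e]]].
    rewrite e src_comp //; apply: reach_trans (hA a _ da) _; last by exists b.
    by rewrite -l'w e tgt_comp.
  exists (N + M) => l0; rewrite inE => /orP[/eqP ->|]; first exact: aux.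
  by rewrite addrC => /sM; apply: aux.
exists (n + M) => l lu /factor[a [b [da db ab e]]].
rewrite e src_comp //; apply: (sM a) => //.
by apply/(enum_paths _ es); split => //; rewrite -lu e tgt_comp.
Qed.

Lemma sat_refl v : sat v v.
Proof. by exists 0 => l lv _; exists l. Qed.

(** Follow a path from [u] long enough for [v], then extend it far enough for [w]; such paths exist
    because there are no sources. *)
Lemma sat_common v w u : sat v u -> sat w u -> exists2 t, reach v t & reach w t.
Proof.
move=> [n sv] sw; have [l [lu ln]] := Lsrc u n.
have [m sw'] : sat w (src l) by apply: sat_reach; rewrite lu.
have [l' [l'l l'm]] := Lsrc (src l) m.
exists (src l'); last exact: sw'.
by apply: reach_trans (sv l lu ln) _; exists l'.
Qed.

Lemma nohit_common v w z : z <> 0 -> ~ hit (fun u => ~ sat v u) z ->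
  ~ hit (fun u => ~ sat w u) z -> exists2 t, reach v t & reach w t.
Proof.
move/hit_neq0 => [[u q] uz _] hv hw; apply: (@sat_common v w u).
  by apply: contrapT => nu; apply: hv; exists (u, q).
by apply: contrapT => nu; apply: hw; exists (u, q).
Qed.

Lemma nohit_gen v q : ~ hit (fun u => ~ sat v u) (tgen v q).
Proof. move/(hit_gen _ _ (@sat_branching v)); apply; exact: sat_refl. Qed.

Lemma tle_trans x y z : tle x y -> tle y z -> tle x z.
Proof. by move=> [a ->] [b ->]; exists (a + b); rewrite addrA. Qed.

Lemma tle_act q x y : tle x y -> tle (tact q x) (tact q y).
Proof. by move=> [a ->]; exists (tact q a); rewrite raddfD. Qed.

Lemma tle_gen x : x <> 0 -> exists v q, tle (tgen v q) x.
Proof.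
have [[|[v q] w] ->] := tpi_surj x; first by [].
by move=> _; exists v, q, (tpi w); rewrite tpiE big_cons tpiE.
Qed.

Lemma tle_path (l : mor L) q : tle (tgen (src l) (q + natZ (deg l))) (tgen (tgt l) q).
Proof.
have [s es] := row_finite_enum (tgt l) (deg l) Lfin.
have ls : l \in s by apply/(enum_paths _ es).
exists (\sum_(a <- rem l s) tgen (src a) (q + natZ (deg l))).
by rewrite (tgen_rel _ es) (big_rem _ ls).
Qed.

Lemma talented_directedP :
  talented_downward_directed L <-> downward_directed L.
Proof.
split=> [dd v w|dd x y /tle_gen[v [p vx]] /tle_gen[w [q wy]]].
  have [z [n [m [z0 zv zw]]]] := dd _ _ (@tgen_neq0 v 0) (@tgen_neq0 w 0).
  (* Every letter of an element below a shift of [u] lies in the saturation of [u]. *)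
  have low u r : tle z (tact r (tgen u 0)) -> ~ hit (fun t => ~ sat u t) z.
    move=> zu; have [_ _ down _] := nohit_ideal (@sat_branching u).
    by apply: down zu _; rewrite tact_gen; apply: nohit_gen.
  exact: nohit_common z0 (low v _ zv) (low w _ zw).
have [t [l lv lt] [m mw mt]] := dd v w.
(* Moving along [l] and [m] gives copies of [t] in degrees [a] and [b]; nonnegative shifts then make
   these degrees equal. *)
pose a := p + natZ (deg l); pose b := q + natZ (deg m).
have [n [n' e]] := natZ_directed a b.
exists (tgen t (a + natZ n)), n, n'; split; first exact: tgen_neq0.
  rewrite -tact_gen; apply: tle_act; apply: tle_trans vx.
  by rewrite -lt -lv; apply: tle_path.
rewrite e -tact_gen; apply: tle_act; apply: tle_trans wy.
by rewrite -mt -mw; apply: tle_path.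
Qed.

Lemma zero_ideal : order_ideal [set 0 : talented L].
Proof.
suff -> : [set 0 : talented L] = [set x | ~ hit (fun=> True) x].
  exact/nohit_ideal/branching_True.
apply/seteqP; split=> x /=; rewrite hit_neq0; first by move=> ->.
exact: contrapT.
Qed.

Lemma prime_order_idealP : prime_order_ideal [set 0 : talented L] <->
  inhabited (obj L) /\ downward_directed L.
Proof.
split=> [[_ proper pr]|[[v0] dd]].
  split.
    apply: contrapT => no; apply: proper; apply/seteqP; split=> // x _ /=.
    by apply: contrapT => /tle_gen[v _]; apply: no.
  move=> v w; apply: contrapT => nt.
  (* The ideals of elements supported on the saturations of [v] and [w] are nonzero, but without a
     common descendant they meet only in 0. *)
  have [] := pr _ _ (nohit_ideal (@sat_branching v))
                  (nohit_ideal (@sat_branching w)).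
  - move=> z [zv zw] /=; apply: contrapT => z0.
    by apply: nt; apply: nohit_common z0 zv zw.
  - by move=> /(_ _ (@nohit_gen v 0))/tgen_neq0.
  - by move=> /(_ _ (@nohit_gen w 0))/tgen_neq0.
split; first exact: zero_ideal.
  move=> e; have : [set: talented L] (tgen v0 0) by [].
  by rewrite -e => /tgen_neq0.
move=> J1 J2 [_ _ down1 act1] [_ _ down2 act2] J12.
have [?|/existsNP[x /not_implyP[J1x x0]]] := pselect (J1 `<=` [set 0]).
  by left.
right=> y J2y; apply: contrapT => y0.
have [z [n [m [z0 zx zy]]]] := (talented_directedP.2 dd) x y x0 y0.
by apply: z0; apply: J12; split; [apply: down1 zx _; apply: act1|
  apply: down2 zy _; apply: act2].
Qed.

End Talented.

(** * Transport of primeness along isomorphisms of talented monoids *)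

Lemma talented_iso_inv (k : nat) (L M : kgraph k) : talented_iso L M ->
  exists (f : {additive talented L -> talented M})
         (g : {additive talented M -> talented L}),
  [/\ cancel f g, cancel g f, forall q x, f (tact q x) = tact q (f x)
    & forall q x, g (tact q x) = tact q (g x)].
Proof.
move=> [f [[g fK gK] fact]].
have gN : nmod_morphism g.
  split=> [|x y]; apply: (can_inj fK); first by rewrite gK raddf0.
  by rewrite raddfD !gK.
pose g' : {additive talented M -> talented L} :=
  HB.pack g (GRing.isNmodMorphism.Build _ _ g gN).
exists f, g'; split=> // q x.
by apply: (can_inj fK); rewrite fact !gK.
Qed.

Lemma talented_iso_sym (k : nat) (L M : kgraph k) :
  talented_iso L M -> talented_iso M L.
Proof.
by move=> /talented_iso_inv[f [g [fK gK _ ?]]]; exists g; split=> //; exists f.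
Qed.

Lemma order_ideal_preimage (k : nat) (L M : kgraph k)
    (f : {additive talented L -> talented M}) (J : set (talented M)) :
  (forall q x, f (tact q x) = tact q (f x)) ->
  order_ideal J -> order_ideal (f @^-1` J).
Proof.
move=> fact [J0 JD Jd Ja]; split=> /=.
- by rewrite raddf0.
- by move=> x y Jx Jy; rewrite raddfD; apply: JD.
- by move=> x y [z ->] /=; apply: Jd; exists (f z); exact: raddfD.
- by move=> q x Jx; rewrite fact; apply: Ja.
Qed.

Lemma prime_order_ideal_iso (k : nat) (L M : kgraph k) : talented_iso L M ->
  prime_order_ideal [set 0 : talented L] ->
  prime_order_ideal [set 0 : talented M].
Proof.
move=> /talented_iso_inv[f [g [fK gK fact gact]]] [id0 proper pr].
have sub0 (J : set (talented M)) : f @^-1` J `<=` [set 0] -> J `<=` [set 0].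
  by move=> sub y Jy /=; rewrite -(gK y) (sub (g y)) ?raddf0 //= gK.
split.
- suff -> : [set 0 : talented M] = g @^-1` [set 0].
    exact: order_ideal_preimage.
  apply/seteqP; split=> x /=; first by move=> ->; rewrite raddf0.
  by move=> gx; rewrite -(gK x) gx raddf0.
- move=> e; apply: proper; apply/seteqP; split=> // x _ /=.
  rewrite -(fK x); have : [set: talented M] (f x) by [].
  by rewrite -e => /= ->; rewrite raddf0.
- move=> J1 J2 /(order_ideal_preimage fact) i1 /(order_ideal_preimage fact) i2 J12.
  have [||] := pr _ _ i1 i2; [|by move/sub0; left|by move/sub0; right].
  by move=> x h /=; rewrite -(fK x) (J12 (f x)) ?raddf0.
Qed.

(** * A representation on germs of functions on long paths *)

Section Representation.
Variables (F : fieldType) (k : nat) (L : kgraph k).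
Hypotheses (Lsrc : no_sources L).
Implicit Types (l x y : mor L) (n : Zk k) (N M : Nk k) (t : kterm F L).

(** The path [x] with its initial segment [l] removed, if there is one; the result is unique by
    [comp_inj]. *)
Definition lquot l x : option (mor L) :=
  if pselect (exists y, src l = tgt y /\ x = kcomp l y) is left e
  then Some (projT1 (cid e)) else None.

Variant lquot_spec l x : option (mor L) -> Prop :=
| LquotSome y of src l = tgt y & x = kcomp l y : lquot_spec l x (Some y)
| LquotNone of (forall y, src l = tgt y -> x <> kcomp l y) : lquot_spec l x None.

Lemma lquotP l x : lquot_spec l x (lquot l x).
Proof.
rewrite /lquot; case: pselect => [e|ne].
  by case: (cid e) => y /= [ly xe]; constructor.
by constructor => y ly xe; apply: ne; exists y.
Qed.

Lemma lquotK l y : src l = tgt y -> lquot l (kcomp l y) = Some y.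
Proof.
move=> ly; case: lquotP => [z lz e|/(_ y ly)//].
by have [_ ->] := comp_inj ly lz erefl e.
Qed.

Lemma lquot_diff l m y : src l = tgt y -> deg l = deg m -> l != m ->
  lquot m (kcomp l y) = None.
Proof.
move=> ly lm /eqP nlm; case: lquotP => // z mz e; case: nlm.
by have [-> _] := comp_inj ly mz lm e.
Qed.

Lemma lquot_comp l m x : src l = tgt m ->
  lquot (kcomp l m) x = obind (lquot m) (lquot l x).
Proof.
move=> lm; have slm := src_comp lm.
case: (lquotP l x) => [y ly ->|nl] /=; last first.
  case: lquotP => // z; rewrite slm => mz e; exfalso.
  apply: (nl (kcomp m z)); first by rewrite tgt_comp.
  by rewrite Defs.compA.
case: (lquotP m y) => [z mz ye|nm].
  by rewrite ye Defs.compA // lquotK // slm.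
case: lquotP => // z; rewrite slm => mz; rewrite -Defs.compA // => e.
have [|_ yz] := comp_inj ly _ erefl e; first by rewrite tgt_comp.
by case: (nm z).
Qed.

Definition long N x := exists M, deg x = N + M.

Lemma long_addl N N' x : long (N + N') x -> long N x.
Proof. by move=> [M dx]; exists (N' + M); rewrite dx addrA. Qed.

Lemma long_addr N N' x : long (N + N') x -> long N' x.
Proof. by rewrite addrC; apply: long_addl. Qed.

(** Germs are needed for the relation writing [p_v] as a sum over v L^n: it can fail on a path
    without an initial segment of degree [n]. *)
Definition germ_eq (f g : mor L -> Zk k -> F) :=
  exists N, forall x, long N x -> forall n, f x n = g x n.

Lemma germ_refl f g : (forall x n, f x n = g x n) -> germ_eq f g.
Proof. by move=> fg; exists 0. Qed.

Lemma germ_sym f g : germ_eq f g -> germ_eq g f.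
Proof. by move=> [N h]; exists N => x /h fg n. Qed.

Lemma germ_trans f g h : germ_eq f g -> germ_eq g h -> germ_eq f h.
Proof.
move=> [N hN] [M hM]; exists (N + M) => x Nx n.
by rewrite hN ?hM //; [apply: long_addr Nx|apply: long_addl Nx].
Qed.

(* The algebra acts on functions on [mor L] modulo equality on all paths of
   large degree.  The extra argument in Z^k records the degree, so that an
   element of degree [g] shifts it by [g]. *)
Fixpoint kact t (f : mor L -> Zk k -> F) : mor L -> Zk k -> F :=
  match t with
  | kP v => fun x n => if tgt x == v then f x n else 0
  | kS l => fun x n =>
      if lquot (val l) x is Some y then f y (n - natZ (deg (val l))) else 0
  | kSs l => fun x n =>
      if src (val l) == tgt x then f (kcomp (val l) x) (n + natZ (deg (val l)))
      else 0
  | k0 => fun _ _ => 0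
  | kadd a b => fun x n => kact a f x n + kact b f x n
  | kopp a => fun x n => - kact a f x n
  | kscale c a => fun x n => c * kact a f x n
  | kmul a b => kact a (kact b f)
  end.

(** Needed to compose actions in products. Only [kS l] shortens the path it evaluates on, so there
    the threshold grows by the degree of [l]. *)
Lemma kact_germ t f g : germ_eq f g -> germ_eq (kact t f) (kact t g).
Proof.
elim: t f g => /= [v|l|l||a IHa b IHb|a IHa|c a IHa|a IHa b IHb] f g fg.
- by have [N h] := fg; exists N => x /h e n; rewrite e.
- have [N h] := fg; exists (deg (val l) + N) => x [M dx] n.
  case: lquotP => // y ly xe; rewrite h //; exists M.
  apply: (@Nk_addIr k (deg (val l))); rewrite -[LHS]addrC -[RHS]addrC.
  by rewrite -(deg_comp ly) -xe dx addrA.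
- have [N h] := fg; exists N => x [M dx] n; case: eqP => // lx; rewrite h //.
  by exists (deg (val l) + M); rewrite deg_comp // dx addrCA.
- exact: germ_refl.
- have [N hN] := IHa _ _ fg; have [M hM] := IHb _ _ fg.
  exists (N + M) => x Nx n.
  by rewrite hN ?hM //; [apply: long_addr Nx|apply: long_addl Nx].
- by have [N h] := IHa _ _ fg; exists N => x /h e n; rewrite e.
- by have [N h] := IHa _ _ fg; exists N => x /h e n; rewrite e.
- exact/IHa/IHb.
Qed.

(** Linearity in the function, here and in [kactZ], is what the relations [kc_mulDr] and
    [kc_scaleAr] require. *)
Lemma kactD t f g :
  kact t (fun x n => f x n + g x n) = fun x n => kact t f x n + kact t g x n.
Proof.
elim: t f g => /= [v|l|l||a IHa b IHb|a IHa|c a IHa|a IHa b IHb] f g;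
  rewrite ?IHa ?IHb //; apply/funext => x; apply/funext => n.
- by case: eqP; rewrite ?addr0.
- by case: lquot; rewrite ?addr0.
- by case: eqP; rewrite ?addr0.
- by rewrite addr0.
- by rewrite addrACA.
- by rewrite opprD.
- by rewrite mulrDr.
Qed.

Lemma kactZ t c f :
  kact t (fun x n => c * f x n) = fun x n => c * kact t f x n.
Proof.
elim: t f => /= [v|l|l||a IHa b IHb|a IHa|d a IHa|a IHa b IHb] f;
  rewrite ?IHa ?IHb //; apply/funext => x; apply/funext => n.
- by case: eqP; rewrite ?mulr0.
- by case: lquot; rewrite ?mulr0.
- by case: eqP; rewrite ?mulr0.
- by rewrite mulr0.
- by rewrite mulrDr.
- by rewrite mulrN.
- by rewrite mulrCA.
Qed.

(** A long path has a unique initial segment [a] of degree [N]. Only the summand of [a] can be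
    nonzero at that path, and it occurs exactly when the path has target [v]. *)
Lemma kact_sum v N (s : seq (nvmor L)) f : enumerates (map val s) (paths v N) ->
  germ_eq (kact (kP F v) f)
    (kact (\big[@kadd F k L/k0 F L]_(l <- s) kmul (kS F l) (kSs F l)) f).
Proof.
move=> es; exists N => x [M /factor[a [b [da db ab xe]]]] n.
pose G (l : nvmor L) := kact (kmul (kS F l) (kSs F l)) f x n.
transitivity (\sum_(l <- s) G l); last first.
  by rewrite unlock; elim: (s) => //= l s' ->.
have Ga (l : nvmor L) : val l = a -> G l = f x n.
  by move=> la; rewrite /G /= la xe lquotK // ab eqxx subrK.
have G0 (l : nvmor L) : val l \in map val s -> val l != a -> G l = 0.
  move=> /(enum_paths _ es)[_ dl] la.
  by rewrite /G /= xe lquot_diff // ?da ?dl // eq_sym.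
rewrite /=; case: eqP => [xv|xv].
  have : a \in map val s.
    by apply/(enum_paths _ es); split=> //; rewrite -xv xe tgt_comp.
  case/mapP => l ls al; rewrite (bigD1_seq l) /=; last 2 first.
  - exact: ls.
  - by have [/map_uniq] := es.
  rewrite Ga // big_seq_cond big1 ?addr0 // => l' /andP[l's nl].
  by apply: G0; [apply: map_f|rewrite al (inj_eq val_inj)].
rewrite big_seq big1 // => l ls; apply: G0; first exact: map_f.
apply/eqP => la; apply: xv; rewrite xe tgt_comp // -la.
by have /(enum_paths _ es)[] := map_f val ls.
Qed.

Lemma kact_cong t t' : kcong t t' -> forall f, germ_eq (kact t f) (kact t' f).
Proof.
elim=> {t t'}.
- by move=> x f; apply: germ_refl.
- by move=> x y _ IH f; apply: germ_sym.
- by move=> x y z _ IH _ IH' f; apply: germ_trans (IH f) (IH' f).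
- move=> x x' y y' _ IH _ IH' f /=.
  have [N hN] := IH f; have [M hM] := IH' f; exists (N + M) => z Nz n.
  by rewrite hN ?hM //; [apply: long_addr Nz|apply: long_addl Nz].
- by move=> x x' _ IH f; have [N h] := IH f; exists N => z /h e n /=; rewrite e.
- by move=> a x x' _ IH f; have [N h] := IH f; exists N => z /h e n /=; rewrite e.
- move=> x x' y y' _ IH _ IH' f /=.
  by apply: germ_trans (IH _); apply: kact_germ.
- by move=> x y z f; apply: germ_refl => u n /=; rewrite addrA.
- by move=> x y f; apply: germ_refl => u n /=; rewrite addrC.
- by move=> x f; apply: germ_refl => u n /=; rewrite add0r.
- by move=> x f; apply: germ_refl => u n /=; rewrite addNr.
- by move=> a b x f; apply: germ_refl => u n /=; rewrite mulrA.
- by move=> x f; apply: germ_refl => u n /=; rewrite mul1r.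
- by move=> a x y f; apply: germ_refl => u n /=; rewrite mulrDr.
- by move=> a b x f; apply: germ_refl => u n /=; rewrite mulrDl.
- by move=> x y z f; apply: germ_refl.
- by move=> x y z f; apply: germ_refl.
- by move=> x y z f; apply: germ_refl => u n /=; rewrite kactD.
- by move=> a x y f; apply: germ_refl.
- by move=> a x y f; apply: germ_refl => u n /=; rewrite kactZ.
- move=> u v f; apply: germ_refl => x n /=.
  have [<-|uv] /= := eqVneq u v; first by case: eqP.
  by case: eqP => // ->; rewrite (negPf uv).
- move=> l m p lm e f; apply: germ_refl => x n /=; rewrite e lquot_comp //.
  case: lquot => //= y; case: lquot => //= z.
  by rewrite deg_comp // natZD opprD addrA.
- move=> l m p lm e f; apply: germ_refl => x n /=; rewrite e src_comp //.
  case: eqP => // mx; rewrite tgt_comp // lm eqxx Defs.compA // deg_comp //.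
  by rewrite natZD -addrA [natZ _ + _]addrC.
- move=> l f; apply: germ_refl => x n /=.
  by case: lquotP => [y ly ->|_]; rewrite ?if_same // tgt_comp ?eqxx.
- move=> l f; apply: germ_refl => x n /=.
  by case: lquotP => // y -> _; rewrite eqxx.
- move=> l f; apply: germ_refl => x n /=.
  by case: (eqVneq (src (sval l)) (tgt x)).
- move=> l f; apply: germ_refl => x n /=.
  by case: eqP => // lx; rewrite tgt_comp ?eqxx.
- move=> l m lm f; apply: germ_refl => x n /=.
  have [<-|nlm] /= := eqVneq l m.
    by rewrite eq_sym; case: eqP => // lx; rewrite lquotK // addrK.
  by case: eqP => // lx; rewrite lquot_diff.
- move=> v n s _ es f; exact (kact_sum f es).
Qed.

Definition KPact (a : KP F L) := kact (repr a).

Lemma KPact_pi t f : germ_eq (KPact (kpi t) f) (kact t f).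
Proof. exact/kact_cong/kcong_repr. Qed.

Lemma KPactD (a b : KP F L) f :
  germ_eq (KPact (a + b) f) (fun x n => KPact a f x n + KPact b f x n).
Proof. exact: KPact_pi. Qed.

Lemma KPactZ c (a : KP F L) f :
  germ_eq (KPact (c *: a) f) (fun x n => c * KPact a f x n).
Proof. exact: KPact_pi. Qed.

Lemma KPactM (a b : KP F L) f : germ_eq (KPact (rmul a b) f) (KPact a (KPact b f)).
Proof. exact: KPact_pi. Qed.

Lemma KPact0 f : germ_eq (KPact 0 f) (fun _ _ => 0).
Proof. exact: (KPact_pi (k0 F L)). Qed.

Definition supported n (f : mor L -> Zk k -> F) :=
  exists N, forall x, long N x -> forall m, m <> n -> f x m = 0.

Lemma supported_germ n f g : germ_eq f g -> supported n g -> supported n f.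
Proof.
move=> [N hN] [M hM]; exists (N + M) => x Nx m mn.
by rewrite hN ?hM //; [apply: long_addr Nx|apply: long_addl Nx].
Qed.

Definition shifts (g : Zk k) (a : KP F L) :=
  forall f n, supported n f -> supported (n + g) (KPact a f).

Lemma shifts0 g : shifts g 0.
Proof. by move=> f n _; apply: supported_germ (KPact0 f) _; exists 0. Qed.

Lemma shiftsD g a b : shifts g a -> shifts g b -> shifts g (a + b).
Proof.
move=> ha hb f n nf; apply: supported_germ (KPactD a b f) _.
have [N hN] := ha f n nf; have [M hM] := hb f n nf.
exists (N + M) => x Nx m mn.
by rewrite hN ?hM ?addr0 //; [apply: long_addr Nx|apply: long_addl Nx].
Qed.

Lemma shiftsZ g c a : shifts g a -> shifts g (c *: a).
Proof.
move=> ha f n nf; apply: supported_germ (KPactZ c a f) _.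
have [N hN] := ha f n nf.
by exists N => x Nx m mn; rewrite hN ?mulr0.
Qed.

Lemma shiftsM g h a b : shifts g a -> shifts h b -> shifts (g + h) (rmul a b).
Proof.
move=> ha hb f n nf; apply: supported_germ (KPactM a b f) _.
by rewrite [g + h]addrC addrA; apply/ha/hb.
Qed.

Lemma shifts_p v : shifts 0 (KPp F v).
Proof.
move=> f n [N nf]; apply: supported_germ (KPact_pi _ f) _.
by exists N => x Nx m; rewrite addr0 /= => mn; rewrite nf ?if_same.
Qed.

Lemma shifts_s (l : nvmor L) : shifts (natZ (deg (val l))) (KPs F l).
Proof.
move=> f n [N nf]; apply: supported_germ (KPact_pi _ f) _.
exists (deg (val l) + N) => x [M dx] m mn /=.
case: lquotP => // y ly xe; rewrite nf //.
  exists M; apply: (@Nk_addIr k (deg (val l))).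
  rewrite -[LHS]addrC -[RHS]addrC.
  by rewrite -(deg_comp ly) -xe dx addrA.
by move=> e; apply: mn; rewrite -e subrK.
Qed.

Lemma shifts_ss (l : nvmor L) : shifts (- natZ (deg (val l))) (KPss F l).
Proof.
move=> f n [N nf]; apply: supported_germ (KPact_pi _ f) _.
exists N => x [M dx] m mn /=; case: eqP => // lx; rewrite nf //.
  by exists (deg (val l) + M); rewrite deg_comp // dx addrCA.
by move=> e; apply: mn; rewrite -e addrK.
Qed.

(** Act on the indicator [f0] of the coordinate 0. Terms of nonzero degree move it off that
    coordinate, while [KPp F v] keeps the value 1 there on long paths with target [v]. *)
Lemma KPp_shifts_neq0 v (s : seq (Zk k * KP F L)) :
  (forall t : Zk k * KP F L, t \in s -> t.1 <> 0 /\ shifts t.1 t.2) ->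
  KPp F v + \sum_(t <- s) t.2 <> 0.
Proof.
move=> hs e; pose f0 (x : mor L) (n : Zk k) : F := (n == 0)%:R.
have f00 : supported 0 f0 by exists 0 => x _ m /eqP/negPf e0; rewrite /f0 e0.
have [N hN] : exists N, forall x, long N x ->
    KPact (\sum_(t <- s) t.2) f0 x 0 = 0.
  elim: s hs {e} => [_|t s IH hs].
    by have [N h] := KPact0 f0; exists N => x /h e; rewrite big_nil e.
  have [N hN] := IH (fun (u : Zk k * KP F L) h => hs u (mem_behead (s := t :: s) h)).
  have [t0 /(_ f0 0 f00)[M hM]] := hs t (mem_head _ _).
  rewrite big_cons; have [P hP] := KPactD t.2 (\sum_(t' <- s) t'.2) f0.
  exists (N + M + P) => x lx; rewrite hP; last exact: long_addr lx.
  have lx' := long_addl lx.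
  rewrite (hN x (long_addl lx')) (hM x (long_addr lx')) ?addr0 //.
  by rewrite add0r => /esym.
have [M hM] := KPactD (KPp F v) (\sum_(t <- s) t.2) f0.
have [P hP] := KPact_pi (kP F v) f0; have [Q hQ] := KPact0 f0.
(* Adding the four thresholds makes all the germ equalities hold at this one path. *)
have [x [xv dx]] := Lsrc v (N + M + P + Q).
have lx : long (N + M + P + Q) x by exists 0; rewrite addr0.
have lx1 := long_addl lx; have lx2 := long_addl lx1.
have := hM x (long_addr lx2) 0.
rewrite e (hQ x (long_addr lx)) (hN x (long_addl lx2)) (hP x (long_addr lx1)) /=.
by rewrite xv eqxx /f0 eqxx addr0 => /eqP; rewrite eq_sym oner_eq0.
Qed.

End Representation.

(** * Arithmetic in rings without unit *)

Section RngTheory.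
Variable R : rngType.
Implicit Types x y : R.

Lemma rmul0l x : rmul 0 x = 0.
Proof. by apply: (addIr (rmul 0 x)); rewrite -rmulDl !add0r. Qed.

Lemma rmul0r x : rmul x 0 = 0.
Proof. by apply: (addIr (rmul x 0)); rewrite -rmulDr !add0r. Qed.

Lemma rmulNr x y : rmul x (- y) = - rmul x y.
Proof. by apply: (addrI (rmul x y)); rewrite -rmulDr !subrr rmul0r. Qed.

Lemma rmulNl x y : rmul (- x) y = - rmul x y.
Proof. by apply: (addrI (rmul x y)); rewrite -rmulDl !subrr rmul0l. Qed.

Lemma rmul_suml (I : Type) (s : seq I) (f : I -> R) x :
  rmul (\sum_(i <- s) f i) x = \sum_(i <- s) rmul (f i) x.
Proof.
by elim: s => [|i s IH]; rewrite ?big_nil ?rmul0l // !big_cons rmulDl IH.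
Qed.

Lemma rmul_sumr (I : Type) (s : seq I) (f : I -> R) x :
  rmul x (\sum_(i <- s) f i) = \sum_(i <- s) rmul x (f i).
Proof.
by elim: s => [|i s IH]; rewrite ?big_nil ?rmul0r // !big_cons rmulDr IH.
Qed.

End RngTheory.

Local Notation "x ** y" := (rmul x y) (at level 40, left associativity).

(** * The grading of the Kumjian-Pask algebra *)

Section Graded.
Variables (F : fieldType) (k : nat) (L : kgraph k).
Hypotheses (Lfin : row_finite L).
Implicit Types (v w : obj L) (l m : mor L) (n N M : Nk k) (g h : Zk k).
Implicit Types (x y : KP F L).

Local Notation p v := (KPp F v).

Lemma morP l : (exists v, l = idm v) \/ exists l' : nvmor L, l = val l'.
Proof.
have [/deg0_id ->|dl] := eqVneq (deg l) 0; first by left; exists (tgt l).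
by right; exists (exist _ l dl).
Qed.

(** Extends the generators to all paths: [insub] fails exactly in degree 0, where [l] is the
    identity of [tgt l]. *)
Definition pathS l : KP F L := if insub l is Some l' then KPs F l' else p (tgt l).
Definition pathSs l : KP F L := if insub l is Some l' then KPss F l' else p (tgt l).
Local Notation S := pathS.
Local Notation Ss := pathSs.

Lemma S_val (l : nvmor L) : S (val l) = KPs F l.
Proof. by rewrite /S valK. Qed.

Lemma Ss_val (l : nvmor L) : Ss (val l) = KPss F l.
Proof. by rewrite /Ss valK. Qed.

Lemma S_id v : S (idm v) = p v.
Proof. by rewrite /S insubN ?deg_id ?eqxx // tgt_id. Qed.

Lemma Ss_id v : Ss (idm v) = p v.
Proof. by rewrite /Ss insubN ?deg_id ?eqxx // tgt_id. Qed.

Lemma pp v w : p v ** p w = if v == w then p v else 0.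
Proof. by have [PP _ _ _ _] := KP_family F L; apply: PP. Qed.

Lemma pS l : p (tgt l) ** S l = S l.
Proof.
have [_ _ PS _ _] := KP_family F L.
have [[v ->]|[l' ->]] := morP l; first by rewrite S_id tgt_id pp eqxx.
by rewrite S_val; have [] := PS l'.
Qed.

Lemma Sp l : S l ** p (src l) = S l.
Proof.
have [_ _ PS _ _] := KP_family F L.
have [[v ->]|[l' ->]] := morP l; first by rewrite S_id src_id pp eqxx.
by rewrite S_val; have [] := PS l'.
Qed.

Lemma pSs l : p (src l) ** Ss l = Ss l.
Proof.
have [_ _ PS _ _] := KP_family F L.
have [[v ->]|[l' ->]] := morP l; first by rewrite Ss_id src_id pp eqxx.
by rewrite Ss_val; have [] := PS l'.
Qed.

Lemma Ssp l : Ss l ** p (tgt l) = Ss l.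
Proof.
have [_ _ PS _ _] := KP_family F L.
have [[v ->]|[l' ->]] := morP l; first by rewrite Ss_id tgt_id pp eqxx.
by rewrite Ss_val; have [] := PS l'.
Qed.

Lemma SM_SsM l m : src l = tgt m ->
  S l ** S m = S (kcomp l m) /\ Ss m ** Ss l = Ss (kcomp l m).
Proof.
move=> lm; have [_ SS _ _ _] := KP_family F L.
have [[v lv]|[l' le]] := morP l.
  rewrite lv src_id in lm *; rewrite lm.
  by rewrite S_id Ss_id comp_idl pS Ssp.
have [[w mw]|[m' me]] := morP m.
  rewrite mw tgt_id in lm *; rewrite -lm.
  by rewrite S_id Ss_id comp_idr Sp pSs.
have dn : deg (kcomp l m) != 0.
  apply/eqP; rewrite deg_comp // => /Nk_add_eq0/eqP.
  by rewrite le => e; have /negP[] := valP l'.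
pose n' : nvmor L := exist (fun l => deg l != 0) _ dn.
rewrite -[kcomp l m]/(val n') le me !S_val !Ss_val.
by apply: SS; rewrite /= -?le -?me.
Qed.

Lemma SM l m : src l = tgt m -> S l ** S m = S (kcomp l m).
Proof. by case/SM_SsM. Qed.

Lemma SsM l m : src l = tgt m -> Ss m ** Ss l = Ss (kcomp l m).
Proof. by case/SM_SsM. Qed.

Lemma SsS l m : deg l = deg m -> Ss l ** S m = if l == m then p (src l) else 0.
Proof.
have [_ _ _ SS _] := KP_family F L.
have [[v ->]|[l' ->]] := morP l.
  rewrite deg_id => /esym/deg0_id ->; rewrite Ss_id S_id pp src_id.
  by rewrite (inj_eq (can_inj (@tgt_id _ L))).
have [[w ->]|[m' ->]] := morP m.
  by rewrite deg_id => /eqP; have /negPf -> := valP l'.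
by move=> lm; rewrite Ss_val S_val (inj_eq val_inj) SS.
Qed.

Lemma p_sum v n s : enumerates s (paths v n) -> p v = \sum_(l <- s) S l ** Ss l.
Proof.
have [_ _ _ _ PS] := KP_family F L => es; have [n0|n0] := eqVneq n 0.
  subst n; rewrite (perm_big [:: idm v]) /=.
    by rewrite big_seq1 S_id Ss_id pp eqxx.
  have [us _] := es; apply: uniq_perm => // l; rewrite inE; apply/idP/eqP.
    by move=> /(enum_paths _ es)[<- /deg0_id].
  by move=> ->; apply/(enum_paths _ es); rewrite tgt_id deg_id.
have se : map val (pmap (insub : _ -> option (nvmor L)) s) = s.
  rewrite (pmap_filter (@insubK _ _ _)); apply/all_filterP/allP => l.
  by move=> /(enum_paths _ es)[_ ln]; rewrite isSome_insub ln.
rewrite (PS v n (pmap insub s) n0); last by rewrite se.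
by rewrite -{2}se big_map; apply: eq_bigr => l _; rewrite S_val Ss_val.
Qed.

(** * Spans of the products [S l ** Ss m] with both degrees fixed *)

Definition level N M x := exists2 s : seq (F * (mor L * mor L)),
  forall t, t \in s -> [/\ deg t.2.1 = N, deg t.2.2 = M & src t.2.1 = src t.2.2]
  & x = \sum_(t <- s) t.1 *: (S t.2.1 ** Ss t.2.2).

Lemma levelS N M l m : deg l = N -> deg m = M -> src l = src m ->
  level N M (S l ** Ss m).
Proof.
move=> dl dm lm; exists [:: (1, (l, m))].
  by move=> t; rewrite inE => /eqP ->.
by rewrite big_seq1 scale1r.
Qed.

Lemma level0 N M : level N M 0.
Proof. by exists [::]; rewrite ?big_nil. Qed.

Lemma levelD N M x y : level N M x -> level N M y -> level N M (x + y).
Proof.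
move=> [s hs ->] [s' hs' ->]; exists (s ++ s'); last by rewrite big_cat.
by move=> t; rewrite mem_cat => /orP[/hs|/hs'].
Qed.

Lemma levelZ N M c x : level N M x -> level N M (c *: x).
Proof.
move=> [s hs ->]; exists [seq (c * t.1, t.2) | t <- s].
  by move=> _ /mapP[t /hs ht ->].
by rewrite big_map scaler_sumr; apply: eq_bigr => t _; rewrite scalerA.
Qed.

Lemma level_sum (I : eqType) (s : seq I) N M (f : I -> KP F L) :
  (forall i, i \in s -> level N M (f i)) -> level N M (\sum_(i <- s) f i).
Proof.
move=> hs; rewrite big_seq; elim/big_ind: _ => //; first exact: level0.
exact: levelD.
Qed.

(** Insert [p (src l)] between the two factors and expand it as a sum over the paths of degree
    [n]. *)
Lemma level_raise N M n x : level N M x -> level (N + n) (M + n) x.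
Proof.
move=> [s hs ->]; apply: level_sum => -[c [l m]] /hs[/= dl dm lm].
apply: levelZ; have [e he] := row_finite_enum (src l) n Lfin.
rewrite -(Sp l) (p_sum he) rmul_sumr rmul_suml; apply: level_sum => a.
move=> /(enum_paths _ he)[ta da].
rewrite !rmulA SM // -rmulA SsM -?lm //.
by apply: levelS; rewrite ?deg_comp ?src_comp -?lm ?dl ?dm ?da.
Qed.

Lemma level_mul N P M x y : level N P x -> level P M y -> level N M (x ** y).
Proof.
move=> [s hs ->] [s' hs' ->]; rewrite rmul_suml.
apply: level_sum => -[c [l m]] /hs[/= dl dm lm]; rewrite rmul_sumr.
apply: level_sum => -[d [l' m']] /hs'[/= dl' dm' lm'].
rewrite rscaleAl rscaleAr; apply/levelZ/levelZ.
rewrite rmulA -(rmulA (S l)) SsS ?dm //.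
case: eqP => [e|_]; last by rewrite rmul0r rmul0l; apply: level0.
by rewrite -lm Sp; apply: levelS; rewrite // lm e.
Qed.

(** Collect the terms with the same pair of paths as the first one. If their total coefficient
    vanishes, drop them and induct; otherwise [Ss l] and [S m] annihilate all other terms. *)
Lemma level_coef N M x : level N M x -> x <> 0 -> exists l m c,
  [/\ deg l = N, deg m = M, src l = src m, c != 0 &
      Ss l ** x ** S m = c *: p (src l)].
Proof.
move=> [s]; elim: {s}(size s) {-2}s (leqnn (size s)) x => [|n IH] s sn x hs xe x0.
  by case: x0; rewrite xe; case: s sn {hs xe}; rewrite ?big_nil.
case: s sn hs xe => [|t0 s] sn hs xe; first by case: x0; rewrite xe big_nil.
have [dl dm lm] := hs _ (mem_head _ _); set l := t0.2.1 in dl lm.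
set m := t0.2.2 in dm lm; pose c := \sum_(t <- t0 :: s | t.2 == t0.2) t.1.
have part : \sum_(t <- t0 :: s | t.2 == t0.2) t.1 *: (S t.2.1 ** Ss t.2.2) =
            c *: (S l ** Ss m).
  by rewrite /c scaler_suml; apply: eq_bigr => t /eqP ->.
have [c0|c0] := eqVneq c 0.
  apply: (IH [seq t <- s | t.2 != t0.2] _ x) => //.
  - by rewrite size_filter (leq_trans (count_size _ _)).
  - by move=> t; rewrite mem_filter => /andP[_ ts]; apply: hs; rewrite inE ts orbT.
  - rewrite xe (bigID (fun t => t.2 == t0.2)) /= part c0 scale0r add0r.
    by rewrite big_cons eqxx /= big_filter.
exists l, m, c; split=> //.
have E t : t \in t0 :: s -> Ss l ** (t.1 *: (S t.2.1 ** Ss t.2.2)) ** S m =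
    if t.2 == t0.2 then t.1 *: p (src l) else 0.
  move=> /hs; case: t => d [l' m'] /= [dl' dm' lm'].
  rewrite rscaleAr rscaleAl rmulA -rmulA !SsS ?dl ?dm' //.
  rewrite [t0.2]surjective_pairing -/l -/m xpair_eqE [l' == l]eq_sym.
  have [ll|_] /= := eqVneq l l'; last by rewrite rmul0l scaler0.
  have [mm|_] /= := eqVneq m' m; last by rewrite rmul0r scaler0.
  by rewrite -lm' -ll pp eqxx.
rewrite xe rmul_sumr rmul_suml big_seq (eq_bigr _ E) -big_seq.
by rewrite -big_mkcond /= -scaler_suml.
Qed.

(** * Homogeneous elements and leading terms *)

Definition homog g x := exists N M, g = natZ N - natZ M /\ level N M x.

Lemma homog0 g : homog g 0.
Proof.
have [n [m]] := natZ_directed g 0; rewrite add0r => e.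
by exists m, n; rewrite -e addrK; split=> //; apply: level0.
Qed.

(** Raising [x] by [M'] and [y] by [M] puts both in the same level, because the two pairs of degrees
    have equal differences. *)
Lemma homogD g x y : homog g x -> homog g y -> homog g (x + y).
Proof.
move=> [N [M [-> hx]]] [N' [M' [e hy]]].
exists (N + M'), (M + M'); split.
  by rewrite !natZD opprD addrACA subrr addr0.
apply: levelD; first exact: level_raise.
have -> : N + M' = N' + M.
  apply: natZ_inj; rewrite !natZD -[natZ N](subrK (natZ M)) e.
  by rewrite addrAC subrK.
by rewrite [M + M']addrC; apply: level_raise.
Qed.

Lemma homogZ g c x : homog g x -> homog g (c *: x).
Proof. by move=> [N [M [e hx]]]; exists N, M; split; last exact: levelZ. Qed.

(** Raising [x] by [N'] and [y] by [M] makes the inner degrees agree. *)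
Lemma homogM g h x y : homog g x -> homog h y -> homog (g + h) (x ** y).
Proof.
move=> [N [M [-> hx]]] [N' [M' [-> hy]]].
exists (N + N'), (M' + M); split.
  by rewrite !natZD opprD addrACA [- natZ M + _]addrC.
apply: (level_mul (level_raise N' hx)); rewrite addrC.
exact: level_raise.
Qed.

Lemma homog_sum (I : eqType) (s : seq I) (P : pred I) g (f : I -> KP F L) :
  (forall i, i \in s -> P i -> homog g (f i)) ->
  homog g (\sum_(i <- s | P i) f i).
Proof.
move=> hs; rewrite big_seq_cond; elim/big_ind: _; first exact: homog0.
  exact: homogD.
by move=> i /andP[]; apply: hs.
Qed.

Lemma homogS l : homog (natZ (deg l)) (S l).
Proof.
exists (deg l), 0; rewrite natZ0 subr0; split=> //.
rewrite -(Sp l) -Ss_id; apply: levelS; rewrite ?deg_id ?src_id //.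
Qed.

Lemma homogSs l : homog (- natZ (deg l)) (Ss l).
Proof.
exists 0, (deg l); rewrite natZ0 sub0r; split=> //.
rewrite -(pSs l) -S_id; apply: levelS; rewrite ?deg_id ?src_id //.
Qed.

Lemma homogp v : homog 0 (p v).
Proof. by have := homogS (idm v); rewrite deg_id natZ0 S_id. Qed.

(** Links the algebraic degree to the representation, so that [KPp_shifts_neq0] applies to
    homogeneous terms. *)
Lemma homog_shifts g x : homog g x -> shifts g x.
Proof.
have hS l : shifts (natZ (deg l)) (S l).
  have [[v ->]|[l' ->]] := morP l; last by rewrite S_val; apply: shifts_s.
  by rewrite S_id deg_id natZ0; apply: shifts_p.
have hSs l : shifts (- natZ (deg l)) (Ss l).
  have [[v ->]|[l' ->]] := morP l; last by rewrite Ss_val; apply: shifts_ss.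
  by rewrite Ss_id deg_id natZ0 oppr0; apply: shifts_p.
move=> [N [M [-> [s hs ->]]]]; rewrite big_seq; elim/big_ind: _.
- exact: shifts0.
- by move=> a b; apply: shiftsD.
- move=> [c [l m]] /hs[/= <- <- _]; apply: shiftsZ.
  exact: shiftsM.
Qed.

(** A decomposition is a mere list in which a degree may occur several times. *)
Definition hsum (P : Zk k -> Prop) x := exists2 s : seq (Zk k * KP F L),
  forall t, t \in s -> P t.1 /\ homog t.1 t.2 & x = \sum_(t <- s) t.2.

Lemma hsum_homog (P : Zk k -> Prop) g x : P g -> homog g x -> hsum P x.
Proof.
move=> Pg gx; exists [:: (g, x)]; last by rewrite big_seq1.
by move=> t; rewrite inE => /eqP ->.
Qed.

Lemma hsumD P x y : hsum P x -> hsum P y -> hsum P (x + y).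
Proof.
move=> [s hs ->] [s' hs' ->]; exists (s ++ s'); last by rewrite big_cat.
by move=> t; rewrite mem_cat => /orP[/hs|/hs'].
Qed.

Lemma hsumZ P c x : hsum P x -> hsum P (c *: x).
Proof.
move=> [s hs ->]; exists [seq (t.1, c *: t.2) | t <- s].
  by move=> _ /mapP[t /hs[? ?] ->]; split=> //; apply: homogZ.
by rewrite big_map scaler_sumr.
Qed.

Lemma hsumM (P Q R : Zk k -> Prop) x y :
  (forall g h, P g -> Q h -> R (g + h)) ->
  hsum P x -> hsum Q y -> hsum R (x ** y).
Proof.
move=> PQR [s hs ->] [s' hs' ->].
exists [seq (t.1 + t'.1, t.2 ** t'.2) | t <- s, t' <- s'].
  move=> _ /allpairsP[[t t'] [/= /hs[Pt ht] /hs'[Qt ht'] ->]] /=.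
  by split; [apply: PQR|apply: homogM].
rewrite big_allpairs_dep rmul_suml; apply: eq_bigr => t _.
by rewrite rmul_sumr.
Qed.

Lemma KP_hsum x : hsum (fun=> True) x.
Proof.
have [t ->] := kpi_surj x.
elim: t => [v|l|l||a IHa b IHb|a IHa|c a IHa|a IHa b IHb].
- by apply: hsum_homog (homogp v).
- by have := homogS (val l); rewrite S_val; apply: hsum_homog.
- by have := homogSs (val l); rewrite Ss_val; apply: hsum_homog.
- by exists [::]; rewrite // big_nil.
- by rewrite -KPadd_pi; apply: hsumD.
- rewrite -KPopp_pi (_ : KPopp _ = -1 *: kpi a); first exact: hsumZ.
  by rewrite scaleN1r.
- by rewrite -KPscale_pi; apply: hsumZ.
- by rewrite -KPmul_pi; apply: (hsumM _ IHa IHb).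
Qed.

Lemma leading_term x : x <> 0 -> exists a b v y,
  hsum (@lexneg k) y /\ a ** x ** b = p v + y.
Proof.
have [s hs ->] := KP_hsum x.
elim: {s}(size s) {-2}s (leqnn (size s)) hs => [|n IH] s sn hs s0.
  by case: s0; case: s sn {hs}; rewrite ?big_nil.
have [|g /mapP[t0 t0s ge] gmax] := @lex_max k (map fst s).
  by case: s s0 {sn hs} => //; rewrite big_nil.
rewrite (bigID (fun t => t.1 == g)) /=.
set A := \sum_(t <- s | t.1 == g) t.2.
have hA : homog g A.
  by apply: homog_sum => t /hs[_ ht] /eqP <-.
have [A0|A0] := pselect (A = 0).
  rewrite A0 add0r -big_filter; apply: IH.
  (* The list gets shorter because [t0] has degree [g]. *)
  - rewrite size_filter -ltnS (leq_trans _ sn) // ltnNge.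
    apply/negP => h; have /allP/(_ _ t0s) : all (fun t => t.1 != g) s.
      by rewrite all_count eqn_leq count_size.
    by rewrite ge eqxx.
  - by move=> t; rewrite mem_filter => /andP[_ /hs].
  - by rewrite big_filter => B0; apply: s0;
      rewrite (bigID (fun t => t.1 == g)) /= -/A A0 B0 addr0.
have [N [M [gNM lA]]] := hA.
have [l [m [c [dl dm lm c0 e]]]] := level_coef lA A0.
exists (c^-1 *: Ss l), (S m), (src l).
eexists; split; last first.
  rewrite rmulDr rmulDl rscaleAl rscaleAl e scalerA mulVf // scale1r.
  by congr (_ + _).
rewrite -big_filter rmul_sumr rmul_suml.
(* Each remaining degree [h] becomes [h - g], which is negative since [g] is maximal. *)
exists [seq (- natZ N + t.1 + natZ M, c^-1 *: Ss l ** t.2 ** S m) |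
         t <- s & t.1 != g]; last by rewrite big_map.
move=> _ /mapP[t + ->]; rewrite mem_filter => /andP[/eqP tg ts] /=.
have [_ ht] := hs t ts; split.
  have [//|] := gmax t.1 (map_f _ ts).
  by rewrite /lexneg gNM !opprD opprK addrAC.
rewrite -dl -dm; apply: homogM (homogS m).
by apply: homogM ht; apply/homogZ/homogSs.
Qed.

End Graded.

(** * Primeness *)

Section Prime.
Variables (F : fieldType) (k : nat) (L : kgraph k).
Hypotheses (Lfin : row_finite L) (Lsrc : no_sources L).
Implicit Types (v w : obj L) (x y : KP F L).

Local Notation p v := (KPp F v).

Lemma KPp_lexneg_neq0 v y : hsum (@lexneg k) y -> p v + y <> 0.
Proof.
move=> [s hs ->]; apply: KPp_shifts_neq0 => // t /hs[gt ht].
by split; [apply: lexneg_neq0|apply: homog_shifts].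
Qed.

Lemma KPp_neq0 v : p v <> 0.
Proof.
rewrite -[p v]addr0; apply: KPp_lexneg_neq0.
by exists [::]; rewrite ?big_nil.
Qed.

Lemma ideal_leading (I : set (KP F L)) : ring_ideal I -> ~ I `<=` [set 0] ->
  exists v, forall t, reach v t -> exists2 y, hsum (@lexneg k) y & I (p t + y).
Proof.
move=> [_ _ Il Ir] /existsNP[x /not_implyP[Ix x0]].
have [a [b [v [y [hy e]]]]] := leading_term Lfin x0.
have Ivy : I (p v + y) by rewrite -e; apply/Ir/Il.
(* Conjugation by [l] turns [p v] into [p (src l)] and preserves all degrees. *)
exists v => _ [l lv <-]; exists (pathSs F l ** y ** pathS F l).
  have [s hs ->] := hy; rewrite rmul_sumr rmul_suml.
  exists [seq (- natZ (deg l) + t.1 + natZ (deg l), pathSs F l ** t.2 ** pathS F l)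
         | t <- s]; last by rewrite big_map.
  move=> _ /mapP[t /hs[gt ht] ->] /=; split; first by rewrite addrAC addNr add0r.
  by apply: (homogM Lfin _ (homogS F l)); apply: (homogM Lfin _ ht); apply: homogSs.
have <- : pathSs F l ** (p v + y) ** pathS F l =
    p (src l) + pathSs F l ** y ** pathS F l.
  by rewrite rmulDr rmulDl -lv Ssp SsS // eqxx.
exact/Ir/Il.
Qed.

Lemma prime_ringP :
  prime_ring (KP F L) <-> inhabited (obj L) /\ downward_directed L.
Proof.
split=> [[_ proper pr]|[[v0] dd]].
  split.
    apply: contrapT => no; apply: proper; apply/seteqP; split=> // x _ /=.
    have [s hs ->] := KP_hsum Lfin x; rewrite big_seq big1 // => t /hs[_].
    move=> [N [M [_ [[|[c [l m]] s'] hs' ->]]]]; first by rewrite big_nil.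
    by case: no; exists; exact: (tgt l).
  move=> v w; apply: contrapT => nt.
  (* A spanning element [S l ** Ss m] survives only if [tgt l = v] and [tgt m = w], and then
     [src l = src m] is a common descendant. *)
  have vw x : p v ** x ** p w = 0.
    have [s hs ->] := KP_hsum Lfin x; rewrite rmul_sumr rmul_suml.
    rewrite big_seq big1 // => -[g a] /hs[_ [N [M [_ [s' hs' /= ->]]]]].
    rewrite rmul_sumr rmul_suml big_seq big1 // => -[c [l m]] /hs'[/= _ _ lm].
    rewrite rscaleAr rscaleAl -(pS F l) -(Ssp F m) !rmulA pp.
    case: eqP => [vl|_]; last by rewrite !rmul0l scaler0.
    rewrite -!rmulA pp; case: eqP => [mw|_]; last by rewrite !rmul0r scaler0.
    by case: nt; exists (src l); [exists l|exists m].
  have vw0 : p v ** p w = 0.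
    rewrite pp; case: eqP => // e; case: nt; exists v; first exact: reach_refl.
    by rewrite -e; apply: reach_refl.
  (* [J] annihilates [p v KP] on the right and [I] annihilates [J] on the left;
     this avoids generating ideals in a ring without unit. *)
  pose J : set (KP F L) := [set y | p v ** y = 0 /\ forall x, p v ** x ** y = 0].
  pose I : set (KP F L) := [set x | forall y, J y -> x ** y = 0].
  have Jl a y : J y -> J (a ** y).
    by move=> [y1 y2]; split=> [|x]; rewrite rmulA // -(rmulA _ x) y2.
  have iJ : ring_ideal J.
    split=> //.
    - by split=> [|x]; rewrite rmul0r.
    - move=> y z [y1 y2] [z1 z2]; split=> [|x]; rewrite rmulDr rmulNr.
        by rewrite y1 z1 subr0.
      by rewrite y2 z2 subr0.
    - by move=> a y [y1 y2]; split=> [|x]; rewrite rmulA ?y1 ?y2 rmul0l.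
  have iI : ring_ideal I.
    split.
    - by move=> y _; rewrite rmul0l.
    - by move=> x z hx hz y Jy; rewrite rmulDl rmulNl hx // hz // subr0.
    - by move=> a x hx y Jy; rewrite -rmulA hx // rmul0r.
    - by move=> a x hx y Jy; rewrite -rmulA; apply/hx/Jl.
  (* Here [I] contains [p v] by the first clause of [J], and [J] contains [p w] by [vw0] and
     [vw]. *)
  have [|sub|sub] := pr I J iI iJ.
  - move=> _ [s hs ->] /=; rewrite big_seq big1 // => t /hs[It Jt].
    exact: It.
  - by apply: (@KPp_neq0 v); apply: sub => y [].
  - by apply: (@KPp_neq0 w); apply: sub.
split.
- split=> [//|x y -> ->|a x ->|a x ->] /=; first by rewrite subrr.
    by rewrite rmul0r.
  by rewrite rmul0l.
- move=> e; have : [set: KP F L] (p v0) by [].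
  by rewrite -e => /KPp_neq0.
- move=> I J iI iJ IJ; have [|nI] := pselect (I `<=` [set 0]); first by left.
  have [|nJ] := pselect (J `<=` [set 0]); first by right.
  have [v hv] := ideal_leading iI nI; have [w hw] := ideal_leading iJ nJ.
  have [t vt wt] := dd v w; have [y hy Iy] := hv t vt; have [z hz Jz] := hw t wt.
  have : (p t + y) ** (p t + z) = 0.
    apply: IJ; exists [:: (p t + y, p t + z)]; last by rewrite big_seq1.
    by move=> q; rewrite inE => /eqP ->.
  (* The product is [p t] plus three terms, each with at least one factor of negative degree and the
     other of negative or zero degree. *)
  rewrite rmulDr !rmulDl pp eqxx -addrA => /KPp_lexneg_neq0[].
  have h0 : hsum (fun g : Zk k => g = 0) (p t) by apply: hsum_homog (homogp F t).
  apply: hsumD; first by apply: (hsumM Lfin _ hy h0) => // g h gn ->; rewrite addr0.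
  apply: hsumD; first by apply: (hsumM Lfin _ h0 hz) => // g h ->; rewrite add0r.
  by apply: (hsumM Lfin _ hy hz) => // g h; apply: lexnegD.
Qed.

End Prime.

(** A vertex is assumed where (ii) occurs: for the empty graph (ii) holds vacuously, while the zero
    ideal is not proper in (i) and (iii). *)
Theorem corollary5p2 (F : fieldType) (k : nat) (hk : (1 <= k)%N) :
  (forall L : kgraph k, row_finite L -> no_sources L ->
     (prime_ring (KP F L) <-> prime_order_ideal [set 0 : talented L]) /\
     (inhabited (obj L) ->
        (prime_ring (KP F L) <-> talented_downward_directed L) /\
        (talented_downward_directed L <->
           prime_order_ideal [set 0 : talented L])))
  /\
  (forall L M : kgraph k,
     row_finite L -> no_sources L -> row_finite M -> no_sources M ->
     talented_iso L M -> (prime_ring (KP F L) <-> prime_ring (KP F M))).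
Proof.
split=> [L Lfin Lsrc|L M Lfin Lsrc Mfin Msrc LM].
  rewrite prime_ringP // prime_order_idealP // talented_directedP //; tauto.
have pP (K : kgraph k) : row_finite K -> no_sources K ->
    prime_ring (KP F K) <-> prime_order_ideal [set 0 : talented K].
  by move=> Kfin Ksrc; rewrite prime_ringP // prime_order_idealP.
rewrite !pP //; split; apply: prime_order_ideal_iso => //.
exact: talented_iso_sym.
Qed.
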